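(* Let $d\ge1$ and $n\ge0$ be integers. Let $\phi,\psi_1,\dots,\psi_d$ be kernels of order $n+1$ whose discrete moments $m_r(\phi,u)$ and $m_r(\psi_i,u)$, $r=0,1,\dots,n+1$, $i=1,\dots,d$, are constant in $u\in\mathbb{R}$ and not null; denote these constants by $m_r(\phi)$ and $m_r(\psi_i)$. Then for every $f\in C_b^{n+1}(\mathbb{R}\times\mathbb{R}^{d})$ and every $(x,\mathbf{y})\in\mathbb{R}\times\mathbb{R}^d$, $$\lim_{w\to\infty}w^{n+1}\big(K_{n,w}^{\phi,\psi}f(x,\mathbf{y})-f(x,\mathbf{y})\big)=\sum_{l+|\mathbf{j}|=n+1}\frac{(-1)^n}{l!\,\mathbf{j}!}\sum_{c=0}^{l}\ \sum_{\mathbf{0}\le\mathbf{e}\le\mathbf{j}}\binom{l}{c}\binom{\mathbf{j}}{\mathbf{e}}\frac{m_c(\phi)}{l-c+1}\prod_{i=1}^{d}\frac{m_{e_i}(\psi_i)}{j_i-e_i+1}\ \partial^{(l,\mathbf{j})}f(x,\mathbf{y}),$$ where $l\ge 0$ is an integer and $\mathbf{j},\mathbf{e}\in\mathbb{Z}_+^d$.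
   Context: Notation. For multi-indices $\mathbf{j},\mathbf{e}\in\mathbb{Z}_+^d$ (non-negative integer entries): $|\mathbf{j}|=j_1+\dots+j_d$, $\mathbf{j}!=\prod_i j_i!$, $\mathbf{e}\le\mathbf{j}$ means $e_i\le j_i$ for all $i$, $\binom{\mathbf{j}}{\mathbf{e}}=\frac{\mathbf{j}!}{\mathbf{e}!(\mathbf{j}-\mathbf{e})!}$, and $\mathbf{x}^{\mathbf{j}}=\prod_i x_i^{j_i}$ for $\mathbf{x}\in\mathbb{R}^d$; $0^0=1$. Points of $\mathbb{R}\times\mathbb{R}^d$ are written $(x,\mathbf{y})$; $\partial^{(l,\mathbf{j})}f=\frac{\partial^{l+|\mathbf{j}|}f}{\partial x^l\partial y_1^{j_1}\cdots\partial y_d^{j_d}}$. Function spaces. $C_b^{m}(\mathbb{R}\times\mathbb{R}^d)$ is the space of $m$-times continuously differentiable real functions all of whose partial derivatives of order at most $m$ are bounded and continuous. Kernels and moments. For $\chi:\mathbb{R}\to\mathbb{R}$, $\beta\ge0$ and integer $r\ge0$ put $M_\beta(\chi)=\sup_{u\in\mathbb{R}}\sum_{k\in\mathbb{Z}}|u-k|^{\beta}|\chi(u-k)|$ and $m_r(\chi,u)=\sum_{k\in\mathbb{Z}}(k-u)^{r}\chi(u-k)$. For an integer $N\ge0$, $\chi$ is a kernel of order $N$ if (i) $\sum_{k\in\mathbb{Z}}\chi(u-k)=1$ for every $u\in\mathbb{R}$; (ii) the series $\sum_{k\in\mathbb{Z}}|u-k|^{N}|\chi(u-k)|$ is uniformly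 convergent in $u\in\mathbb{R}$ in the sense that it converges for every $u$ and $\lim_{R\to\infty}\sup_{u\in\mathbb{R}}\sum_{k\in\mathbb{Z},\,|u-k|\ge R}|u-k|^{N}|\chi(u-k)|=0$, and $M_\beta(\chi)<\infty$ for all $0\le\beta\le N$. Operator. For $w>0$, $k\in\mathbb{Z}$, $\mathbf{m}\in\mathbb{Z}^d$ let $I_k^w=[\frac{k}{w},\frac{k+1}{w}]$ and $I_{\mathbf{m}}^w=\prod_{i=1}^d[\frac{m_i}{w},\frac{m_i+1}{w}]$. The Hermite-type sampling Kantorovich operator is $$K_{n,w}^{\phi,\psi}f(x,\mathbf{y})=\sum_{k\in\mathbb{Z}}\sum_{\mathbf{m}\in\mathbb{Z}^d}\phi(wx-k)\prod_{i=1}^d\psi_i(wy_i-m_i)\left(\sum_{l+|\mathbf{j}|\le n}\frac{1}{l!\,\mathbf{j}!}\,w^{d+1}\int_{I_k^w}\int_{I_{\mathbf{m}}^w}\frac{\partial^{l+|\mathbf{j}|}f(u,\mathbf{v})}{\partial u^l\partial\mathbf{v}^{\mathbf{j}}}(x-u)^l(\mathbf{y}-\mathbf{v})^{\mathbf{j}}\,d\mathbf{v}\,du\right),$$ where the inner sum is over integers $l\ge0$ and $\mathbf{j}\in\mathbb{Z}_+^d$. *)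

(* Defs.v *)
From HB Require Import structures.
From mathcomp Require Import all_boot all_order all_algebra.
From mathcomp Require Import all_classical all_reals all_analysis.

Set Implicit Arguments.
Unset Strict Implicit.
Unset Printing Implicit Defensive.

Import Order.TTheory GRing.Theory Num.Theory.
Import numFieldNormedType.Exports.

Local Open Scope classical_set_scope.
Local Open Scope ring_scope.

(* Sum of an absolutely convergent real family, as the difference of the sums
   of its positive and negative parts; 0 if the family is not absolutely
   summable. *)
Definition asum (R : realType) (T : choiceType) (a : T -> R) : R :=
  fine (\esum_(i in [set: T]) (EFin \o a)^\+ i
        - \esum_(i in [set: T]) (EFin \o a)^\- i)%E.

Section multi_index.
Variables (R : realType) (d N : nat).
Implicit Types j e : {ffun 'I_d -> 'I_N}.

(* Multi-indices occur only in sums that bound |j|, hence every entry. *)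
Definition mdeg j : nat := (\sum_i j i)%N.
Definition mfact j : nat := (\prod_i (j i)`!)%N.
Definition mle e j : bool := [forall i, (e i <= j i)%N].
Definition mbinom j e : R :=
  (mfact j)%:R / ((mfact e)%:R * (\prod_i (j i - e i)`!)%:R).
Definition mpow (x : 'rV[R]_d) j : R := \prod_i x 0 i ^+ j i.

End multi_index.

Section partial_derivatives.
Variables (R : realType) (d : nat).
Implicit Types f : R * 'rV[R]_d -> R.

(* [None] is the direction of x, [Some i] that of y_i. *)
Definition coord_dir (i : option 'I_d) : R * 'rV[R]_d :=
  if i is Some i' then (0, delta_mx 0 i') else (1, 0).

Definition partial (i : option 'I_d) f : R * 'rV[R]_d -> R :=
  'D_(coord_dir i) f.

Definition mpartial N (l : nat) (j : {ffun 'I_d -> 'I_N}) f :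
    R * 'rV[R]_d -> R :=
  iter l (partial None)
    (foldr (fun i g => iter (j i) (partial (Some i)) g) f (enum 'I_d)).

(* C_b^m(R x R^d): all iterated partial derivatives of order at most m, in any order of
   differentiation, exist and are continuous and bounded. *)
Fixpoint Cb (m : nat) f : Prop :=
  [/\ continuous f,
      exists M : R, forall p, `|f p| <= M
    & if m is m'.+1 then
        forall i, (forall p, derivable f p (coord_dir i)) /\ Cb m' (partial i f)
      else True].

End partial_derivatives.

Section kernels.
Variable R : realType.
Implicit Types (chi : R -> R) (u : R).

Definition abs_moment (beta : R) chi : \bar R :=
  ereal_sup (range (fun u => \esum_(k in [set: int])
    (`|u - k%:~R| `^ beta * `|chi (u - k%:~R)|)%:E)).

Definition moment (r : nat) chi u : R :=
  asum (fun k : int => (k%:~R - u) ^+ r * chi (u - k%:~R)).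

Definition kernel_of_order (N : nat) chi : Prop :=
  [/\ forall u, asum (fun k : int => chi (u - k%:~R)) = 1,
      forall u, (\esum_(k in [set: int])
        (`|u - k%:~R| ^+ N * `|chi (u - k%:~R)|)%:E < +oo)%E,
      ereal_sup (range (fun u => \esum_(k in [set k : int | r <= `|u - k%:~R|])
        (`|u - k%:~R| ^+ N * `|chi (u - k%:~R)|)%:E)) @[r --> (+oo : set_system R)] --> 0%E
    & forall beta : R, 0 <= beta <= N%:R -> (abs_moment beta chi < +oo)%E].

End kernels.

(* Integral over the box \prod_i I i, as an iterated Lebesgue integral
   with the 0-th coordinate outermost. *)
Fixpoint box_integral (R : realType) (d : nat) :
    ('I_d -> set R) -> ('rV[R]_d -> R) -> R :=
  match d with
  | 0 => fun _ g => g 0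
  | d'.+1 => fun I g =>
      \int[lebesgue_measure]_(t in I ord0)
        box_integral (fun i => I (lift ord0 i))
          (fun v : 'rV[R]_d' => g (row_mx (t%:M : 'rV[R]_1) v))
  end.

Section operator.
Variables (R : realType) (d : nat).

Definition cell (w : R) (k : int) : set R :=
  `[k%:~R / w, (k%:~R + 1) / w]%classic.

Definition hermite_kantorovich (n : nat) (phi : R -> R) (psi : 'I_d -> R -> R)
    (w : R) (f : R * 'rV[R]_d -> R) (x : R) (y : 'rV[R]_d) : R :=
  asum (fun k : int => asum (fun m : 'rV[int]_d =>
    phi (w * x - k%:~R) * (\prod_(i < d) psi i (w * y 0 i - (m 0 i)%:~R)) *
    \sum_(l < n.+1)
      \sum_(j : {ffun 'I_d -> 'I_n.+1} | (l + mdeg j <= n)%N)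
        (1 / ((l`!)%:R * (mfact j)%:R) * w ^+ d.+1 *
         \int[lebesgue_measure]_(u in cell w k)
           box_integral (fun i => cell w (m 0 i))
             (fun v => mpartial l j f (u, v) * (x - u) ^+ l * mpow (y - v) j)))).

End operator.

(* Main.v *)
Require Import Defs.
From HB Require Import structures.
From mathcomp Require Import all_boot all_order all_algebra.
From mathcomp Require Import all_classical all_reals all_analysis.
From mathcomp Require Import ring lra.

Import Order.TTheory GRing.Theory Num.Theory.
Import numFieldNormedType.Exports.

Local Open Scope classical_set_scope.
Local Open Scope ring_scope.

(** Let [p = (x, y)]. In the term of index [(k, m)] the operator takes the mean,
    over the points [q] of a cell of side [1 / w], of the Taylor polynomial of
    degree [n] of [f] based at [q] and evaluated at [p] ([hermite_poly]). This
    polynomial differs from [f p] by a Taylor remainder. With the derivatives of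
    order [n + 1] frozen at [p], the remainder is a form of degree [n + 1] in
    [p - q]; what is left, [hermite_error], is of smaller order.

    The frozen form contributes the limit, and does so without any passage to
    the limit. The mean of [(u - x) ^ l * (v - y) ^ j] over the cell, multiplied
    by [w ^ (l + |j|)], is a product of polynomials in the offsets [k - w x] and
    [m_i - w y_i] ([cell_mean_monomial]). Each of them is integrated by one of
    the kernels to a combination of its discrete moments, which are constant
    ([has_asum_mean_pow]). The remaining constant [f p] is reproduced because
    the kernels sum to [1].

    It remains to see that [w ^ (n + 1)] times the contribution of
    [hermite_error] tends to [0]. At a point [q] whose coordinates are within
    [rho] of those of [p], the error is at most a constant times
    [rho ^ (n + 1)] times the oscillation of the derivatives of order [n + 1] on
    the box of radius [rho] about [p]. The oscillation is small when [rho] is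
    small, by continuity, and always bounded. Cells within a fixed distance of
    [p] thus contribute little since the absolute moments of order [n + 1] are
    bounded, and the other cells contribute little since the tails of these
    moments are uniformly small ([kernel_weight], [weighted_sum]).

    The Taylor estimate ([multi_taylor]) is obtained one coordinate after the
    other, in the order in which [mpartial] differentiates. Mixed derivatives
    are therefore never permuted, and the chain rule is used only along
    coordinate lines, where it is trivial. *)

(** * Absolutely convergent sums *)

Definition nneg_sum {R : realType} {T : choiceType} (b : T -> R) (B : R) :=
  (forall i, 0 <= b i) /\ (\esum_(i in [set: T]) (b i)%:E = B%:E)%E.

(** Presenting a summable family as a difference of nonnegative ones makes
    [has_asum] visibly stable under the algebraic operations, which the
    canonical positive and negative parts in [asum] are not. *)
Definition has_asum {R : realType} {T : choiceType} (a : T -> R) (s : R) :=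
  exists b c B C, [/\ nneg_sum b B, nneg_sum c C,
    forall i, a i = b i - c i & s = B - C].

Section nneg_sums.
Context {R : realType} {T : choiceType}.
Implicit Types (a b c : T -> R) (s A B C k : R).

Lemma nneg_sum_ge0 b B : nneg_sum b B -> 0 <= B.
Proof.
by move=> [b0 bB]; rewrite -lee_fin -bB; apply: esum_ge0 => i _; rewrite lee_fin.
Qed.

Lemma nneg_sum_unique b B C : nneg_sum b B -> nneg_sum b C -> B = C.
Proof. by move=> [_ bB] [_]; rewrite bB => -[]. Qed.

Lemma nneg_sum_exists b B : (forall i, 0 <= b i) ->
  (\esum_(i in [set: T]) (b i)%:E <= B%:E)%E -> exists2 B', nneg_sum b B' & B' <= B.
Proof.
move=> b0 bB; exists (fine (\esum_(i in [set: T]) (b i)%:E)).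
  split=> //; rewrite fineK// ge0_fin_numE; last first.
    by apply: esum_ge0 => i _; rewrite lee_fin.
  exact: le_lt_trans bB (ltry _).
rewrite -lee_fin fineK// ge0_fin_numE ?(le_lt_trans bB (ltry _))//.
by apply: esum_ge0 => i _; rewrite lee_fin.
Qed.

Lemma nneg_sum_le b c C : (forall i, 0 <= b i <= c i) -> nneg_sum c C ->
  exists2 B, nneg_sum b B & B <= C.
Proof.
move=> bc [_ cC]; apply: nneg_sum_exists => [i|]; first by case/andP: (bc i).
by rewrite -cC; apply: le_esum => i _; rewrite lee_fin; case/andP: (bc i).
Qed.

Lemma nneg_sumD b c B C : nneg_sum b B -> nneg_sum c C ->
  nneg_sum (fun i => b i + c i) (B + C).
Proof.
move=> [b0 bB] [c0 cC]; split=> [i|]; first by rewrite addr_ge0.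
rewrite EFinD -bB -cC -esumD//; by move=> i _; rewrite lee_fin.
Qed.

Lemma nneg_sum0 : nneg_sum (fun _ : T => 0) (0 : R).
Proof. by split=> //; rewrite esum1. Qed.

Lemma le_esum_scale k b : 0 <= k -> (forall i, 0 <= b i) ->
  (\esum_(i in [set: T]) (k * b i)%:E <= k%:E * \esum_(i in [set: T]) (b i)%:E)%E.
Proof.
move=> k0 b0; apply: ge_ereal_sup => _ [X [finX _] <-].
have -> : (\sum_(i \in X) (k * b i)%:E = k%:E * \sum_(i \in X) (b i)%:E)%E.
  rewrite ge0_mule_fsumr// => i; by rewrite lee_fin.
apply: lee_wpmul2l; first by rewrite lee_fin.
by apply: esum_ge; exists X.
Qed.

Lemma nneg_sumZ k b B : 0 <= k -> nneg_sum b B ->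
  nneg_sum (fun i => k * b i) (k * B).
Proof.
rewrite le_eqVlt => /predU1P[<- _|k0 [b0 bB]].
  rewrite mul0r; split=> [i|]; first by rewrite mul0r.
  by rewrite esum1// => i _; rewrite mul0r.
have k0' := ltW k0; split=> [i|]; first by rewrite mulr_ge0.
apply/eqP; rewrite eq_le; apply/andP; split.
  by rewrite EFinM -bB le_esum_scale.
have := @le_esum_scale k^-1 (fun i => k * b i).
rewrite invr_ge0 => /(_ k0' (fun i => mulr_ge0 k0' (b0 i))).
under eq_esum do rewrite mulKf ?gt_eqF//.
rewrite bB -(@lee_pmul2l _ k%:E)// muleA -!EFinM.
by rewrite divff ?gt_eqF// mul1e.
Qed.

Lemma asum_diff b c B C : nneg_sum b B -> nneg_sum c C ->
  asum (fun i => b i - c i) = B - C.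
Proof.
move=> [b0 bB] [c0 cC]; rewrite /asum -[RHS]/(fine (B%:E - C%:E)%E) -bB -cC.
congr fine; apply: (@esumB R T [set: T] (EFin \o b) (EFin \o c)).
- rewrite /summable; under eq_esum do rewrite /= ger0_norm//.
  by rewrite bB ltry.
- rewrite /summable; under eq_esum do rewrite /= ger0_norm//.
  by rewrite cC ltry.
- by move=> i _; rewrite lee_fin.
- by move=> i _; rewrite lee_fin.
Qed.

Lemma has_asumE a s : has_asum a s -> asum a = s.
Proof.
move=> [b [c [B [C [bB cC abc ->]]]]]; rewrite -(asum_diff _ _ _ _ bB cC).
by congr asum; apply/funext.
Qed.

Lemma nneg_sum_has_asum b B : nneg_sum b B -> has_asum b B.
Proof.
move=> bB; exists b, (fun=> 0), B, 0; split=> //; first exact: nneg_sum0.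
  by move=> i; rewrite subr0.
by rewrite subr0.
Qed.

Lemma has_asum_nneg b B : (forall i, 0 <= b i) -> has_asum b B -> nneg_sum b B.
Proof.
move=> b0 [b' [c [B' [C [bB cC bbc ->]]]]].
have [|B1 bB1 _] := @nneg_sum_le b b' B' _ bB.
  by move=> i; rewrite b0 bbc gerBl; case: cC => ->.
suff -> : B' - C = B1 by [].
apply/eqP; rewrite subr_eq; apply/eqP; apply: nneg_sum_unique bB _.
have := nneg_sumD _ _ _ _ bB1 cC; congr nneg_sum.
by apply/funext => i; rewrite bbc subrK.
Qed.

Lemma has_asumD a a' s s' : has_asum a s -> has_asum a' s' ->
  has_asum (fun i => a i + a' i) (s + s').
Proof.
move=> [b [c [B [C [bB cC abc ->]]]]] [b' [c' [B' [C' [bB' cC' abc' ->]]]]].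
exists (fun i => b i + b' i), (fun i => c i + c' i), (B + B'), (C + C').
split; [exact: nneg_sumD|exact: nneg_sumD| |by ring].
by move=> i; rewrite abc abc'; ring.
Qed.

Lemma has_asumZ k a s : has_asum a s -> has_asum (fun i => k * a i) (k * s).
Proof.
move=> [b [c [B [C [bB cC abc ->]]]]].
have [k0|k0] := leP 0 k.
  exists (fun i => k * b i), (fun i => k * c i), (k * B), (k * C).
  split; [exact: nneg_sumZ|exact: nneg_sumZ| |by ring].
  by move=> i; rewrite abc; ring.
have {}k0 : 0 <= - k by rewrite oppr_ge0 ltW.
exists (fun i => - k * c i), (fun i => - k * b i), (- k * C), (- k * B).
split; [exact: nneg_sumZ|exact: nneg_sumZ| |by ring].
by move=> i; rewrite abc; ring.
Qed.

Lemma has_asum0 : has_asum (fun _ : T => 0) (0 : R).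
Proof. exact/nneg_sum_has_asum/nneg_sum0. Qed.

Lemma eq_has_asum a a' s : a =1 a' -> has_asum a s -> has_asum a' s.
Proof. by move=> /funext ->. Qed.

Lemma has_asum_sum (I : Type) (r : seq I) (P : pred I) (a : I -> T -> R)
    (s : I -> R) : (forall i, P i -> has_asum (a i) (s i)) ->
  has_asum (fun t => \sum_(i <- r | P i) a i t) (\sum_(i <- r | P i) s i).
Proof.
move=> as_; elim: r => [|i r IH].
  by rewrite big_nil; apply: eq_has_asum has_asum0 => t; rewrite big_nil.
rewrite big_cons; case: ifPn => Pi.
  apply: eq_has_asum (has_asumD _ _ _ _ (as_ _ Pi) IH) => t.
  by rewrite big_cons Pi.
by apply: eq_has_asum IH => t; rewrite big_cons (negbTE Pi).
Qed.

(** Domination is what produces sums: the value is not prescribed, and is later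
    identified through [has_asumE]. *)
Lemma has_asum_le a b B : (forall i, `|a i| <= b i) -> nneg_sum b B ->
  exists2 s, has_asum a s & `|s| <= B.
Proof.
move=> ab bB.
have absE i : `|a i| = Num.max (a i) 0 + Num.max (- a i) 0.
  have [ai|ai] := leP 0 (a i).
    by rewrite ger0_norm// max_r ?addr0 ?oppr_le0.
  by rewrite ltr0_norm// max_l ?add0r ?oppr_ge0 ?ltW.
have [|P aP _] := @nneg_sum_le (fun i => Num.max (a i) 0) b B _ bB.
  move=> i; rewrite le_max lexx orbT/= (le_trans _ (ab i))//.
  by rewrite absE lerDl le_max lexx orbT.
have [|N aN _] := @nneg_sum_le (fun i => Num.max (- a i) 0) b B _ bB.
  move=> i; rewrite le_max lexx orbT/= (le_trans _ (ab i))//.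
  by rewrite absE lerDr le_max lexx orbT.
have [|A aA AB] := @nneg_sum_le (fun i => `|a i|) b B _ bB.
  by move=> i; rewrite normr_ge0 ab.
have AE : A = P + N.
  apply: nneg_sum_unique aA _; have := nneg_sumD _ _ _ _ aP aN.
  by congr nneg_sum; apply/funext => i; rewrite absE.
exists (P - N).
  exists (fun i => Num.max (a i) 0), (fun i => Num.max (- a i) 0), P, N.
  split=> // i; have [ai|ai] := leP 0 (a i).
    by rewrite max_r ?subr0 ?oppr_le0.
  by rewrite max_l ?sub0r ?opprK ?oppr_ge0 ?ltW.
apply: le_trans AB; rewrite AE.
have := nneg_sum_ge0 _ _ aP; have := nneg_sum_ge0 _ _ aN.
by rewrite ler_norml => *; apply/andP; split; lra.
Qed.

End nneg_sums.

Lemma nneg_sumM {R : realType} {T U : choiceType} (b : T -> R) (c : U -> R) B C :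
  nneg_sum b B -> nneg_sum c C ->
  nneg_sum (fun t : T * U => b t.1 * c t.2) (B * C).
Proof.
move=> bB cC; have [b0 bBE] := bB; have [c0 cCE] := cC.
split=> [t|]; first exact: mulr_ge0.
have -> : [set: T * U] = [set: T] `*`` (fun=> [set: U]).
  by apply/seteqP; split.
rewrite -(@esum_esum R T U setT (fun=> setT) (fun t u => (b t * c u)%:E)); last first.
  by move=> t u _ _; rewrite lee_fin mulr_ge0.
under eq_esum => t _ do rewrite (nneg_sumZ _ _ _ (b0 t) cC).2.
rewrite (mulrC B); have [_ <-] := nneg_sumZ _ _ _ (nneg_sum_ge0 _ _ cC) bB.
by apply: eq_esum => t _; rewrite mulrC.
Qed.

Lemma has_asumM {R : realType} {T U : choiceType} (a : T -> R) (a' : U -> R) s s' :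
  has_asum a s -> has_asum a' s' ->
  has_asum (fun t : T * U => a t.1 * a' t.2) (s * s').
Proof.
move=> [b [c [B [C [bB cC abc ->]]]]] [b' [c' [B' [C' [bB' cC' abc' ->]]]]].
exists (fun t => b t.1 * b' t.2 + c t.1 * c' t.2),
  (fun t => b t.1 * c' t.2 + c t.1 * b' t.2),
  (B * B' + C * C'), (B * C' + C * B').
split; [by apply: nneg_sumD; apply: nneg_sumM
       |by apply: nneg_sumD; apply: nneg_sumM| |by ring].
by move=> t; rewrite abc abc'; ring.
Qed.

Lemma reindex_has_asum {R : realType} {T U : choiceType} (e : T -> U) (a : U -> R) s :
  bijective e -> has_asum (a \o e) s -> has_asum a s.
Proof.
move=> be; have be' : set_bij [set: T] [set: U] e by rewrite setTT_bijective.
have [g ge eg] := be.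
have key (b : T -> R) B : nneg_sum b B -> nneg_sum (b \o g) B.
  move=> [b0 bB]; split=> [i|]; first exact: b0.
  rewrite -bB (@reindex_esum R T U setT setT e _ be')/=.
  by apply: eq_esum => t _; rewrite /= ge.
move=> [b [c [B [C [bB cC abc ->]]]]].
exists (b \o g), (c \o g), B, C; split; [exact: key|exact: key| |by []].
by move=> i; rewrite /= -abc /= eg.
Qed.

Lemma row_mx_ord0 {T : Type} d (k : 'rV[T]_1) (m : 'rV[T]_d) :
  (row_mx k m : 'rV[T]_d.+1) 0 ord0 = k 0 0.
Proof.
rewrite -(row_mxEl k m 0 0); congr (row_mx _ _ _ _); exact/val_inj.
Qed.

Lemma row_mx_lift {T : Type} d (k : 'rV[T]_1) (m : 'rV[T]_d) i :
  (row_mx k m : 'rV[T]_d.+1) 0 (lift ord0 i) = m 0 i.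
Proof.
rewrite -(row_mxEr k m 0 i); congr (row_mx _ _ _ _); exact/val_inj.
Qed.

Lemma row_mx_bijective {T : Type} d :
  bijective (fun t : T * 'rV[T]_d =>
    (row_mx (const_mx t.1 : 'rV_1) t.2 : 'rV[T]_d.+1)).
Proof.
exists (fun v : 'rV_d.+1 => (v 0 0, rsubmx (v : 'rV_(1 + d)))).
  move=> [k m] /=; rewrite row_mxKr; congr pair.
  by rewrite (row_mx_ord0 _ (const_mx k)) mxE.
move=> v /=; have -> : const_mx (v 0 0) = lsubmx (v : 'rV_(1 + d)).
  by apply/rowP => i; rewrite !mxE ord1; congr (v _ _); exact/val_inj.
exact: (@hsubmxK _ 1 1 d).
Qed.

(** Fubini for a product family on the lattice, one coordinate at a time. *)
Lemma has_asum_prod {R : realType} d (a : 'I_d -> int -> R) (s : 'I_d -> R) :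
  (forall i, has_asum (a i) (s i)) ->
  has_asum (fun m : 'rV[int]_d => \prod_i a i (m 0 i)) (\prod_i s i).
Proof.
elim: d a s => [|d IH] a s as_.
  rewrite big_ord0; apply/nneg_sum_has_asum; split=> [m|].
    by rewrite big_ord0.
  have -> : [set: 'rV[int]_0] = [set 0].
    by apply/seteqP; split=> // m _ /=; rewrite thinmx0.
  by rewrite esum_set1 ?big_ord0// lee_fin.
apply: (@reindex_has_asum _ _ _ _ _ _ (@row_mx_bijective int d)).
rewrite big_ord_recl.
apply: eq_has_asum (has_asumM _ _ _ _ (as_ ord0) (IH _ _ (fun i => as_ (lift ord0 i)))).
move=> [k m] /=; rewrite big_ord_recl row_mx_ord0 mxE.
by congr (_ * _); apply: eq_bigr => i _; rewrite row_mx_lift.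
Qed.

Section nested_sums.
Context {R : realType} {T U : choiceType}.
Implicit Types (a b : T -> U -> R) (s t : R).

(** The outer sum is taken over the values of the inner ones, as in an iterated
    [asum]; the order of summation is never exchanged. *)
Definition has_asum2 a s :=
  exists v, (forall k, has_asum (a k) (v k)) /\ has_asum v s.

Lemma has_asum2E a s : has_asum2 a s -> asum (fun k => asum (a k)) = s.
Proof.
move=> [v [av vs]]; rewrite -(has_asumE _ _ vs); congr asum.
by apply/funext => k; exact: has_asumE.
Qed.

Lemma eq_has_asum2 a b s : (forall k m, a k m = b k m) -> has_asum2 a s -> has_asum2 b s.
Proof. by move=> ab; have -> : b = a by apply/funext => k; apply/funext. Qed.

Lemma has_asum2D a b s t : has_asum2 a s -> has_asum2 b t ->
  has_asum2 (fun k m => a k m + b k m) (s + t).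
Proof.
move=> [v [av vs]] [v' [bv vt]]; exists (fun k => v k + v' k).
by split=> [k|]; exact: has_asumD.
Qed.

Lemma has_asum2Z c a s : has_asum2 a s -> has_asum2 (fun k m => c * a k m) (c * s).
Proof.
move=> [v [av vs]]; exists (fun k => c * v k).
by split=> [k|]; exact: has_asumZ.
Qed.

Lemma has_asum2_sum (I : Type) (r : seq I) (P : pred I) (a : I -> T -> U -> R)
    (s : I -> R) : (forall i, P i -> has_asum2 (a i) (s i)) ->
  has_asum2 (fun k m => \sum_(i <- r | P i) a i k m) (\sum_(i <- r | P i) s i).
Proof.
move=> as_; elim: r => [|i r IH].
  rewrite big_nil; exists (fun=> 0); split=> [k|]; last exact: has_asum0.
  by apply: eq_has_asum has_asum0 => m; rewrite big_nil.
rewrite big_cons; case: ifPn => Pi.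
  by apply: eq_has_asum2 (has_asum2D _ _ _ _ (as_ _ Pi) IH) => k m; rewrite big_cons Pi.
by apply: eq_has_asum2 IH => k m; rewrite big_cons (negbTE Pi).
Qed.

Lemma has_asum2M (a : T -> R) (b : U -> R) s t : has_asum a s -> has_asum b t ->
  has_asum2 (fun k m => a k * b m) (s * t).
Proof.
move=> as_ bt; exists (fun k => a k * t); split=> [k|]; first exact: has_asumZ.
by rewrite mulrC; apply: eq_has_asum (has_asumZ t _ _ as_) => k; rewrite mulrC.
Qed.

Lemma has_asum2_le a b B : (forall k m, `|a k m| <= b k m) -> has_asum2 b B ->
  exists2 s, has_asum2 a s & `|s| <= B.
Proof.
move=> ab [v [bv vB]].
have b0 k m : 0 <= b k m := le_trans (normr_ge0 _) (ab k m).
have bv' k : nneg_sum (b k) (v k) by exact: has_asum_nneg.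
have {}vB : nneg_sum v B by apply: has_asum_nneg vB => k; exact: nneg_sum_ge0 (bv' k).
have /choice[al al_] k : exists s, has_asum (a k) s /\ `|s| <= v k.
  by have [s] := has_asum_le _ _ _ (ab k) (bv' k); exists s.
have [s als sB] := has_asum_le al v B (fun k => (al_ k).2) vB.
by exists s => //; exists al; split=> // k; case: (al_ k).
Qed.

End nested_sums.

(** * Taylor expansion, one coordinate at a time *)

Lemma is_derive_mul {R : realType} (f g : R -> R) (t df dg : R) :
  is_derive t 1 f df -> is_derive t 1 g dg ->
  is_derive t 1 (fun s => f s * g s) (f t * dg + g t * df).
Proof. by move=> ? ?; exact: is_deriveM. Qed.

Lemma is_derive_taylor_monomial {R : realType} (n : nat) (b t : R) :
  is_derive t 1 (fun s => (b - s) ^+ n.+1 / n.+1`!%:R) (- ((b - t) ^+ n / n`!%:R)).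
Proof.
have d0 : is_derive t 1 (fun s => b - s : R) (- 1).
  have -> : - 1 = 0 - 1 :> R by rewrite sub0r.
  exact: is_deriveB.
have dp : is_derive t 1 (fun s => (b - s) ^+ n.+1) (n.+1%:R * (b - t) ^+ n * - 1).
  have -> : (fun s => (b - s) ^+ n.+1) = (fun s => b - s : R) ^+ n.+1.
    by apply/funext => s; rewrite exprfctE.
  exact: is_deriveX.
have dc : is_derive t 1 (fun _ : R => n.+1`!%:R^-1 : R) 0 by exact: is_derive_cst.
have := is_derive_mul _ _ _ _ _ dp dc.
congr is_derive; rewrite /= mulr0 add0r factS natrM.
have n1 : n.+1%:R != 0 :> R by [].
have n2 : n`!%:R != 0 :> R by rewrite pnatr_eq0 -lt0n fact_gt0.
by field; apply/andP.
Qed.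

(** Regarded as a function of the base point [t], the Taylor polynomial with
    [n.+1] terms has a telescoping derivative. *)
Lemma is_derive_taylor {R : realType} (g : nat -> R -> R) (n : nat) (b t : R) :
  (forall k, (k <= n)%N -> is_derive t 1 (g k) (g k.+1 t)) ->
  is_derive t 1 (fun t => \sum_(k < n.+1) (b - t) ^+ k / k`!%:R * g k t)
    ((b - t) ^+ n / n`!%:R * g n.+1 t).
Proof.
elim: n => [|n IH] dg.
  under eq_fun => s do rewrite big_ord_recl big_ord0 addr0 expr0 fact0 divr1 mul1r.
  by rewrite expr0 fact0 divr1 mul1r; exact: dg.
under eq_fun => s do rewrite big_ord_recr /=.
have := is_deriveD (IH (fun k kn => dg k (leqW kn)))
  (is_derive_mul _ _ _ _ _ (is_derive_taylor_monomial n b t) (dg n.+1 (leqnn _))).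
congr is_derive; ring.
Qed.

(** The mean value theorem, applied to the expansion as a function of its base
    point. The last derivative is replaced by a constant [G] close to it, so that
    no intermediate point has to be named. *)
Lemma taylor_remainder {R : realType} (g : nat -> R -> R) (n : nat) (a b G om : R) :
  (forall k (t : R), (k <= n)%N -> is_derive t 1 (g k) (g k.+1 t)) ->
  (forall t, `|t - b| <= `|a - b| -> `|g n.+1 t - G| <= om) ->
  `|g 0%N b - \sum_(k < n.+1) (b - a) ^+ k / k`!%:R * g k a
    - (b - a) ^+ n.+1 / n.+1`!%:R * G| <= `|b - a| ^+ n.+1 * om.
Proof.
move=> dg gG.
(* [h] is the expansion based at [t]; it equals [g 0 b] at [t = b]. *)
pose h t := \sum_(k < n.+1) (b - t) ^+ k / k`!%:R * g k t
    + (b - t) ^+ n.+1 / n.+1`!%:R * G.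
pose dh t := (b - t) ^+ n / n`!%:R * (g n.+1 t - G).
have hh (t : R) : is_derive t 1 h (dh t).
  have dc : is_derive t 1 (fun _ : R => G) 0 by exact: is_derive_cst.
  have := is_deriveD (is_derive_taylor g n b t (fun k => dg k t))
    (is_derive_mul _ _ _ _ _ (is_derive_taylor_monomial n b t) dc).
  by congr is_derive; rewrite /dh /=; ring.
have hb : h b = g 0%N b.
  rewrite /h subrr exprS !mul0r addr0 big_ord_recl expr0 fact0 divr1 mul1r.
  by rewrite big1 ?addr0// => k _; rewrite /= expr0n !mul0r.
have ch : continuous h.
  by move=> t; apply/differentiable_continuous/derivable1_diffP/ex_derive.
have [c cab hc] : exists2 c, `|c - b| <= `|a - b| & h b - h a = dh c * (b - a).
  have [ab|ba] := leP a b.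
    have [c cab hc] := @MVT_segment R h dh a b ab (fun t _ => hh t)
      (continuous_subspaceT ch).
    exists c => //; move: cab; rewrite in_itv /= => /andP[ac cb].
    by rewrite !ler0_norm ?subr_le0// lerN2 lerD2r.
  have [c cab hc] := @MVT_segment R h dh b a (ltW ba) (fun t _ => hh t)
    (continuous_subspaceT ch).
  exists c; last by rewrite -opprB hc; ring.
  move: cab; rewrite in_itv /= => /andP[bc ca].
  by rewrite !ger0_norm ?subr_ge0 ?(ltW ba)// lerD2r.
rewrite -addrA -opprD -/(h a) -hb hc /dh !normrM normrX normfV.
have -> : `|b - a| ^+ n.+1 * om = `|b - a| ^+ n * 1 * om * `|b - a|.
  by rewrite exprS; ring.
rewrite ler_wpM2r// ler_pM ?mulr_ge0 ?exprn_ge0 ?invr_ge0 ?gG// ler_pM//.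
- by rewrite lerXn2r ?nnegrE// distrC (distrC b).
- by rewrite ger0_norm// invf_le1 ?ler1n ?ltr0n fact_gt0.
Qed.

Section coordinates.
Context {R : realType} {d : nat}.
Implicit Types (p q z : R * 'rV[R]_d) (o : option 'I_d) (f : R * 'rV[R]_d -> R).

Definition coord q o : R := if o is Some i then q.2 0 i else q.1.

Lemma coord_ext q z : coord q =1 coord z -> q = z.
Proof.
case: q z => [u v] [u' v'] e; congr pair; first exact: (e None).
by apply/rowP => i; exact: (e (Some i)).
Qed.

Lemma coord_shift z (t : R) o o' :
  coord (z + t *: coord_dir R o) o' = coord z o' + t * (o' == o)%:R.
Proof.
by case: o' o => [i'|] [i|] //=; rewrite ?mxE ?eqxx.
Qed.

Definition mixed_point p q (s : seq (option 'I_d)) : R * 'rV[R]_d :=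
  (if None \in s then q.1 else p.1,
   \row_i (if Some i \in s then q.2 0 i else p.2 0 i)).

Lemma coord_mixed p q s o :
  coord (mixed_point p q s) o = if o \in s then coord q o else coord p o.
Proof. by case: o => [i|] //=; rewrite mxE. Qed.

(** A partial derivative is an ordinary derivative along a coordinate line, both
    being limits of the same difference quotients. *)
Lemma is_derive_line f z o (c t : R) :
  derivable f (z + (t - c) *: coord_dir R o) (coord_dir R o) ->
  is_derive t 1 (fun s : R => f (z + (s - c) *: coord_dir R o))
    (partial o f (z + (t - c) *: coord_dir R o)).
Proof.
move=> df.
have E : (fun h : R => h^-1 *: (((fun s : R => f (z + (s - c) *: coord_dir R o))
      \o shift t) (h *: (1 : R)) - f (z + (t - c) *: coord_dir R o))) =
   (fun h => h^-1 *: ((f \o shift (z + (t - c) *: coord_dir R o))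
      (h *: coord_dir R o) - f (z + (t - c) *: coord_dir R o))).
  apply/funext => h /=; congr (_ *: (f _ - _)).
  rewrite [RHS]addrC -[RHS]addrA -[in RHS]scalerDl.
  by congr (_ + _ *: _); rewrite /GRing.scale /=; ring.
by apply: DeriveDef; rewrite /derivable /partial /derive E.
Qed.

Lemma Cb_le m k f : (k <= m)%N -> Cb m f -> Cb k f.
Proof.
elim: m k f => [|m IH] [|k] f //= km [cf bf df]; split=> // i.
by have [dfi Cf] := df i; split=> //; exact: IH Cf.
Qed.

Lemma Cb_derivable m f o z : Cb m.+1 f -> derivable f z (coord_dir R o).
Proof. by move=> [_ _ df]; have [] := df o. Qed.

Lemma Cb_iter m k o f : (k <= m)%N -> Cb m f -> Cb (m - k) (iter k (partial o) f).
Proof.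
elim: k => [|k IH] km Cf; first by rewrite subn0.
have := IH (ltnW km) Cf; rewrite -(subnSK km) => -[_ _ df].
by have [] := df o.
Qed.

End coordinates.

Section multi_taylor.
Context {R : realType} {d N : nat}.
Local Notation idx := {ffun option 'I_d -> 'I_N.+1}.
Implicit Types (p q z : R * 'rV[R]_d) (o : option 'I_d) (f : R * 'rV[R]_d -> R).
Implicit Types (al : idx) (s : seq (option 'I_d)).

Definition odeg al : nat := (\sum_o al o)%N.
Definition omono p q al : R :=
  \prod_o ((coord p o - coord q o) ^+ al o / (al o)`!%:R).
(** The head of [s] is differentiated last, so that an induction on [s] meets the
    derivatives in the order in which they are taken. *)
Definition opartial s al f := foldr (fun o g => iter (al o) (partial o) g) f s.
Definition osupp s al := [forall o, (o \in s) || (al o == ord0)].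
Definition oset al o (a : 'I_N.+1) : idx := [ffun o' => if o' == o then a else al o'].

Lemma osuppP s al o : osupp s al -> o \notin s -> al o = ord0.
Proof. by move=> /forallP/(_ o) + /negbTE os; rewrite os => /eqP. Qed.

(** A multi-index supported in [o :: s] is one supported in [s] together with its
    entry at [o]. *)
Lemma big_osupp_cons s o (F : idx -> R) : o \notin s ->
  \sum_(be | osupp (o :: s) be) F be =
  \sum_(al | osupp s al) \sum_(a < N.+1) F (oset al o a).
Proof.
move=> os; rewrite pair_big /=.
rewrite (reindex_onto (fun x : idx * 'I_N.+1 => oset x.1 o x.2)
  (fun be => (oset be o ord0, be o))) /=.
  apply: eq_bigl => -[al a] /=; apply/andP/andP.
    move=> [/forallP sal /eqP[eal _]]; split=> //; rewrite -eal.
    apply/forallP => o'; have [->|o'o] := eqVneq o' o.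
      by rewrite !ffunE eqxx eqxx orbT.
    by have := sal o'; rewrite inE (negbTE o'o) /= !ffunE (negbTE o'o).
  move=> [sal _]; split.
    apply/forallP => o'; rewrite inE ffunE; case: eqP => //= _.
    exact: (forallP sal).
  rewrite ffunE eqxx; apply/eqP; congr pair; apply/ffunP => o'.
  rewrite !ffunE; case: eqP => // ->; rewrite (osuppP s al o sal)//.
move=> be _; apply/ffunP => o'; rewrite !ffunE.
by case: eqP => [->|].
Qed.

Lemma odeg_oset al o a : al o = ord0 -> odeg (oset al o a) = (odeg al + a)%N.
Proof.
move=> al0; rewrite /odeg (bigD1 o)//= ffunE eqxx [in RHS](bigD1 o)//= al0 add0n addnC.
by congr (_ + _)%N; apply: eq_bigr => o' o'o; rewrite ffunE (negbTE o'o).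
Qed.

Lemma omono_oset p q al o a : al o = ord0 ->
  omono p q (oset al o a) =
  omono p q al * ((coord p o - coord q o) ^+ a / a`!%:R).
Proof.
move=> al0; rewrite /omono (bigD1 o)//= ffunE eqxx [in RHS](bigD1 o)//= al0.
rewrite expr0 fact0 divr1 mul1r mulrC.
by congr (_ * _); apply: eq_bigr => o' o'o; rewrite ffunE (negbTE o'o).
Qed.

Lemma opartial_oset s al o a f : o \notin s ->
  opartial (o :: s) (oset al o a) f = iter a (partial o) (opartial s al f).
Proof.
move=> os; rewrite /opartial /= ffunE eqxx; congr (iter _ _ _).
elim: s os => //= o' s IH; rewrite inE negb_or eq_sym => /andP[/negbTE o'o os].
by rewrite ffunE o'o IH.
Qed.

Lemma Cb_opartial m s al f : uniq s -> (odeg al <= m)%N -> Cb m f ->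
  Cb (m - odeg al) (opartial s al f).
Proof.
move=> us alm Cf.
have sal : (\sum_(o <- s) al o <= odeg al)%N.
  rewrite /odeg big_uniq//= [leqRHS](bigID (mem s))/= leq_addr//.
suff: Cb (m - \sum_(o <- s) al o) (opartial s al f).
  by apply: Cb_le; rewrite leq_sub2l.
have {alm sal us} := leq_trans sal alm.
elim: s => [|o s IH] /=; first by rewrite big_nil subn0.
rewrite big_cons => ale; rewrite addnC subnDA; apply: Cb_iter.
  by rewrite leq_subRL// ?(leq_trans _ ale) ?leq_addl// addnC.
by apply: IH; rewrite (leq_trans _ ale) ?leq_addl.
Qed.

Lemma omono_le p q al (rho : R) : (forall o, `|coord q o - coord p o| <= rho) ->
  `|omono p q al| <= rho ^+ odeg al.
Proof.
move=> qp; rewrite normr_prod /odeg -prodrXr.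
apply: ler_prod => o _; rewrite normr_ge0 /= normrM normfV normrX.
rewrite -[leRHS]mulr1 ler_pM ?exprn_ge0 ?invr_ge0//.
  by rewrite lerXn2r ?nnegrE ?(le_trans _ (qp o))// distrC.
by rewrite ger0_norm// invf_le1 ?ler1n ?ltr0n fact_gt0.
Qed.

(** The Taylor estimate along the line through [z] in the direction [o]. When
    [m = 0] there is nothing to expand, and replacing [h z] by [G] keeps that case
    exact: in [taylor_step] the terms of top degree [N] are already frozen. *)
Lemma taylor_coord (h : R * 'rV[R]_d -> R) z o (m : nat) (b G om : R) :
  Cb m h ->
  (forall t, `|t - coord z o| <= `|b - coord z o| ->
    `|iter m (partial o) h (z + (t - coord z o) *: coord_dir R o) - G| <= om) ->
  `|(if m is 0 then G else h z)
    - \sum_(a < m.+1) (coord z o - b) ^+ a / a`!%:R *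
       (if (a < m)%N then
          iter a (partial o) h (z + (b - coord z o) *: coord_dir R o) else G)|
  <= `|b - coord z o| ^+ m * om.
Proof.
case: m => [|n] Ch hG.
  rewrite big_ord_recl big_ord0 addr0 /= expr0 fact0 divr1 mul1r subrr normr0 expr0 mul1r.
  by apply: le_trans (hG (coord z o) _) => //; rewrite subrr normr0.
pose g k (t : R) := iter k (partial o) h (z + (t - coord z o) *: coord_dir R o).
have dg k (t : R) : (k <= n)%N -> is_derive t 1 (g k) (g k.+1 t).
  move=> kn; apply: is_derive_line.
  have := @Cb_iter R d n.+1 k o h (leqW kn) Ch; rewrite subSn//.
  exact: Cb_derivable.
have tr := @taylor_remainder R g n b (coord z o) G om dg hG.
have g0 : g 0%N (coord z o) = h z by rewrite /g subrr scale0r addr0.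
rewrite (distrC b) big_ord_recr /= ltnn opprD addrA -g0; apply: le_trans tr.
rewrite le_eqVlt; apply/orP; left; apply/eqP; congr (`|_ - _ - _|).
by apply: eq_bigr => k _; rewrite ltn_ord.
Qed.

Lemma osupp_oset s al o a : osupp s al -> osupp (o :: s) (oset al o a).
Proof.
move=> /forallP sal; apply/forallP => o'; rewrite inE ffunE.
by case: eqVneq => //= _; exact: sal.
Qed.

(** Below the top degree the derivative is evaluated where the coordinates in
    [s] have been moved to [q]; in the top degree it is frozen at [p]. *)
Definition taylor_term s f p q al : R :=
  if (odeg al <= N)%N then
    omono p q al * opartial s al f (if (odeg al < N)%N then mixed_point p q s else p)
  else 0.

(** Expanding each term of degree less than [N] in the next coordinate [o], up to
    total degree [N], yields the terms of [o :: s] that extend it. A nonzero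
    multi-index of degree [N] thus arises at the coordinate expanded last among
    those where it is nonzero, and that is where its derivative gets frozen at
    [p]. *)
Lemma taylor_step s o f p q (rho om : R) al :
  uniq (o :: s) -> Cb N f -> (forall o, `|coord q o - coord p o| <= rho) ->
  (forall be, odeg be = N -> osupp (o :: s) be ->
    forall z, (forall o, `|coord z o - coord p o| <= rho) ->
    `|opartial (o :: s) be f z - opartial (o :: s) be f p| <= om) ->
  osupp s al ->
  `|taylor_term s f p q al - \sum_(a < N.+1) taylor_term (o :: s) f p q (oset al o a)|
    <= rho ^+ N * om.
Proof.
move=> us0 Cf qp fom sal; have /= /andP[os us] := us0.
have al0 : al o = ord0 := osuppP s al o sal os.
have rho0 : 0 <= rho := le_trans (normr_ge0 _) (qp o).
have om0 : 0 <= om.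
  apply: le_trans (fom (oset [ffun=> ord0] o ord_max) _ _ p _); rewrite ?subrr ?normr0//.
  - rewrite odeg_oset ?ffunE//= /odeg big1 ?add0n// => o' _; by rewrite ffunE.
  - by apply: osupp_oset; apply/forallP => o'; rewrite ffunE orbT.
  - by move=> o'; rewrite subrr normr0.
rewrite /taylor_term.
have [dN|dN] := leqP (odeg al) N; last first.
  rewrite big1 ?subr0 ?normr0 ?mulr_ge0 ?exprn_ge0// => a _.
  rewrite odeg_oset// leqNgt (leq_trans dN) ?leq_addr//.
pose m := (N - odeg al)%N; pose h := opartial s al f; pose z := mixed_point p q s.
have mN : (m.+1 <= N.+1)%N by rewrite ltnS leq_subr.
have zo : coord z o = coord p o by rewrite coord_mixed (negbTE os).
have zrho (t : R) : `|t - coord z o| <= `|coord q o - coord z o| ->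
    forall o', `|coord (z + (t - coord z o) *: coord_dir R o) o' - coord p o'| <= rho.
  move=> tq o'; rewrite coord_shift; have [->|o'o] := eqVneq o' o.
    by rewrite mulr1 subrKC -zo (le_trans tq)// zo.
  rewrite mulr0 addr0 coord_mixed; case: ifP => _ //.
  by rewrite subrr normr0.
have move_o : z + (coord q o - coord z o) *: coord_dir R o = mixed_point p q (o :: s).
  apply: coord_ext => o'; rewrite coord_shift !coord_mixed inE.
  have [->|o'o] := eqVneq o' o; first by rewrite (negbTE os) mulr1 subrKC.
  by rewrite mulr0 addr0.
have hE k : (k <= N)%N ->
    iter k (partial o) h = opartial (o :: s) (oset al o (inord k)) f.
  by move=> kN; rewrite opartial_oset// inordK.
have Ch : Cb m h by apply: Cb_opartial.
have hG t : `|t - coord z o| <= `|coord q o - coord z o| ->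
    `|iter m (partial o) h (z + (t - coord z o) *: coord_dir R o)
       - iter m (partial o) h p| <= om.
  move=> tq; rewrite hE ?leq_subr//; apply: fom; [|exact: osupp_oset|exact: zrho].
  by rewrite odeg_oset// inordK ?subnKC.
have tc := taylor_coord h z o m (coord q o) (iter m (partial o) h p) om Ch hG.
have -> : \sum_(a < N.+1) (if (odeg (oset al o a) <= N)%N then
      omono p q (oset al o a) * opartial (o :: s) (oset al o a) f
        (if (odeg (oset al o a) < N)%N then mixed_point p q (o :: s) else p)
    else 0) =
    omono p q al * \sum_(a < m.+1) (coord z o - coord q o) ^+ a / a`!%:R *
       (if (a < m)%N then
          iter a (partial o) h (z + (coord q o - coord z o) *: coord_dir R o)
        else iter m (partial o) h p).
  rewrite (big_ord_widen _ (fun a => (coord z o - coord q o) ^+ a / a`!%:R *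
       (if (a < m)%N then
          iter a (partial o) h (z + (coord q o - coord z o) *: coord_dir R o)
        else iter m (partial o) h p)) mN).
  rewrite mulr_sumr [RHS]big_mkcond; apply: eq_bigr => a _.
  rewrite odeg_oset// -leq_subRL// -/m ltnS; case: ifP => // am.
  rewrite omono_oset// opartial_oset// move_o zo -mulrA; congr (_ * (_ * _)).
  rewrite -ltn_subRL -/m; case: ltnP => // ma.
  by congr (iter _ _ _ _); apply/eqP; rewrite eqn_leq am.
have -> : (if (odeg al < N)%N then z else p) = (if m is 0 then p else z).
  by rewrite -subn_gt0 -/m; case: (m).
have -> : opartial s al f (if m is 0 then p else z) =
    if m is 0 then iter m (partial o) h p else h z.
  by case: (m).
rewrite -mulrBr normrM -[X in rho ^+ X](subnKC dN) exprD -mulrA.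
rewrite ler_pM ?omono_le// (le_trans tc)// ler_wpM2r// zo.
by rewrite lerXn2r ?nnegrE.
Qed.

(** The expansion of [f p] is exact before any coordinate has been moved, and the
    errors of the successive steps add up. *)
Lemma multi_taylor s f p q (rho om : R) :
  uniq s -> Cb N f -> (forall o, `|coord q o - coord p o| <= rho) ->
  (forall be, odeg be = N -> osupp s be ->
    forall z, (forall o, `|coord z o - coord p o| <= rho) ->
    `|opartial s be f z - opartial s be f p| <= om) ->
  `|f p - \sum_(al | osupp s al) taylor_term s f p q al|
    <= (size s * #|idx|)%:R * (rho ^+ N * om).
Proof.
move=> us Cf qp; elim: s us => [|o s IH] us fom.
  (* No coordinate has been moved: only the zero multi-index remains. *)
  rewrite (bigD1 ([ffun=> ord0] : idx))/=; last by apply/forallP => o; rewrite ffunE orbT.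
  rewrite big1 ?addr0 => [|al /andP[/forallP sal /eqP[]]]; last first.
    by apply/ffunP => o; rewrite ffunE; apply/eqP; exact: sal.
  have deg0 : odeg [ffun=> ord0] = 0%N by rewrite /odeg big1// => o _; rewrite ffunE.
  have mono0 : omono p q [ffun=> ord0] = 1.
    by rewrite /omono big1// => o _; rewrite ffunE expr0 fact0 divr1.
  have pp : mixed_point p q [::] = p by apply: coord_ext => o; rewrite coord_mixed.
  by rewrite /taylor_term deg0 mono0 pp /= if_same mul1r subrr normr0 mul0n mul0r.
have /andP[os us'] := us.
have fom' : forall be, odeg be = N -> osupp s be ->
    forall z, (forall o, `|coord z o - coord p o| <= rho) ->
    `|opartial s be f z - opartial s be f p| <= om.
  move=> be dbe sbe z zp; have be0 := osuppP s be o sbe os.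
  have -> : opartial s be f = opartial (o :: s) be f by rewrite /opartial /= be0.
  apply: fom => //; apply/forallP => o'; rewrite inE -orbA.
  by rewrite (forallP sbe) orbT.
rewrite big_osupp_cons//=.
have -> : f p - \sum_(al | osupp s al) \sum_(a < N.+1)
     taylor_term (o :: s) f p q (oset al o a) =
   (f p - \sum_(al | osupp s al) taylor_term s f p q al) +
   \sum_(al | osupp s al) (taylor_term s f p q al -
     \sum_(a < N.+1) taylor_term (o :: s) f p q (oset al o a)).
  by rewrite sumrB addrA subrK.
rewrite mulSn natrD mulrDl addrC (le_trans (ler_normD _ _))// lerD ?IH//.
have rho0 : 0 <= rho := le_trans (normr_ge0 _) (qp o).
have step al sal := @taylor_step s o f p q rho om al us Cf qp fom sal.
have c0 : 0 <= rho ^+ N * om.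
  apply: le_trans (normr_ge0 _) (step [ffun=> ord0] _).
  by apply/forallP => o'; rewrite ffunE orbT.
rewrite (le_trans (ler_norm_sum _ _ _))// (le_trans (ler_sum _ step))//.
rewrite mulr_natl -sumr_const big_mkcond ler_sum// => al _.
by case: ifP.
Qed.

End multi_taylor.

Lemma big_option {A : Type} {idx : A} {op : Monoid.com_law idx} {T : finType}
    (F : option T -> A) :
  \big[op/idx]_o F o = op (F None) (\big[op/idx]_i F (Some i)).
Proof.
rewrite (bigD1 None)//=; congr (op _ _).
rewrite (reindex_omap Some id) /=; last by case.
by apply: eq_bigl => i; rewrite eqxx.
Qed.

Section hermite_taylor.
Context {R : realType} {d : nat}.
Implicit Types (p q z : R * 'rV[R]_d) (f : R * 'rV[R]_d -> R).

Definition coords : seq (option 'I_d) := None :: map Some (enum 'I_d).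

Lemma coords_uniq : uniq coords.
Proof.
rewrite /coords /= map_inj_uniq ?enum_uniq ?andbT; last by move=> ? ? [].
by apply/negP => /mapP[].
Qed.

Lemma mem_coords o : o \in coords.
Proof.
case: o => [i|]; rewrite inE ?eqxx// mem_map ?mem_enum//.
Qed.

Definition ocons N (l : 'I_N.+1) (j : {ffun 'I_d -> 'I_N.+1}) :
  {ffun option 'I_d -> 'I_N.+1} := [ffun o => if o is Some i then j i else l].

Lemma big_ocons N (F : {ffun option 'I_d -> 'I_N.+1} -> R) :
  \sum_al F al = \sum_l \sum_j F (ocons N l j).
Proof.
rewrite pair_big (reindex (fun x : 'I_N.+1 * {ffun 'I_d -> 'I_N.+1} => ocons N x.1 x.2))//.
exists (fun al : {ffun option 'I_d -> 'I_N.+1} =>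
  (al None, [ffun i => al (Some i)])) => [[l j] _|al _] /=.
  by rewrite ffunE; congr pair; apply/ffunP => i; rewrite !ffunE.
by apply/ffunP => -[i|]; rewrite !ffunE.
Qed.

Lemma odeg_ocons N l j : odeg (ocons N l j) = (l + mdeg j)%N.
Proof.
rewrite /odeg big_option ffunE; congr (_ + _)%N.
by apply: eq_bigr => i _; rewrite ffunE.
Qed.

Lemma omono_ocons N l j p q : omono p q (ocons N l j) =
  1 / ((l`!)%:R * (mfact j)%:R) * ((p.1 - q.1) ^+ l * mpow (p.2 - q.2) j).
Proof.
rewrite /omono big_option ffunE /=.
under eq_bigr => i _ do rewrite ffunE.
have -> : mpow (p.2 - q.2) j = \prod_i (p.2 0 i - q.2 0 i) ^+ j i.
  by apply: eq_bigr => i _; rewrite !mxE.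
rewrite big_split /= prodfV /mfact natr_prod.
by rewrite mul1r invfM mulrACA mulrC; congr (_ * _); rewrite mulrC.
Qed.

Lemma opartial_ocons N l j f : opartial coords (ocons N l j) f = mpartial l j f.
Proof.
rewrite /opartial /mpartial /coords /= ffunE; congr iter.
rewrite foldr_map; elim: (enum 'I_d) => //= i s ->; by rewrite ffunE.
Qed.

Lemma Cb_mpartial N m (l : 'I_N.+1) (j : {ffun 'I_d -> 'I_N.+1}) f :
  (l + mdeg j <= m)%N -> Cb m f -> Cb (m - (l + mdeg j)) (mpartial l j f).
Proof.
rewrite -odeg_ocons -opartial_ocons => ljm Cf.
by apply: Cb_opartial => //; exact: coords_uniq.
Qed.

Lemma Cb_continuous m f : Cb m f -> continuous f.
Proof. by case: m => [|m] []. Qed.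

Lemma Cb_bounded m f : Cb m f -> exists M, forall p, `|f p| <= M.
Proof. by case: m => [|m] []. Qed.

(** The multi-indices of [multi_taylor] run over all coordinates at once; here the
    exponent of [x] is separated from those of [y]. *)
Lemma hermite_taylor N f p q (rho om : R) :
  Cb N f -> (forall o, `|coord q o - coord p o| <= rho) ->
  (forall (l : 'I_N.+1) (j : {ffun 'I_d -> 'I_N.+1}), (l + mdeg j)%N = N ->
    forall z, (forall o, `|coord z o - coord p o| <= rho) ->
    `|mpartial l j f z - mpartial l j f p| <= om) ->
  `|f p -
    (\sum_(l < N.+1) \sum_(j : {ffun 'I_d -> 'I_N.+1} | (l + mdeg j < N)%N)
       1 / ((l`!)%:R * (mfact j)%:R) *
         (mpartial l j f q * (p.1 - q.1) ^+ l * mpow (p.2 - q.2) j)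
     + \sum_(l < N.+1) \sum_(j : {ffun 'I_d -> 'I_N.+1} | (l + mdeg j == N)%N)
       1 / ((l`!)%:R * (mfact j)%:R) *
         (mpartial l j f p * (p.1 - q.1) ^+ l * mpow (p.2 - q.2) j))|
  <= (d.+1 * #|{ffun option 'I_d -> 'I_N.+1}|)%:R * (rho ^+ N * om).
Proof.
move=> Cf qp fom.
have full al : @osupp d N coords al.
  by apply/forallP => o; rewrite mem_coords.
have := @multi_taylor R d N coords f p q rho om coords_uniq Cf qp.
have -> : size coords = d.+1 by rewrite /= size_map size_enum_ord.
under eq_bigl => al do rewrite full.
move=> mt; apply: le_trans (mt _); last first.
  move=> be + _; have -> : be = ocons N (be None) [ffun i => be (Some i)].
    by apply/ffunP => -[i|]; rewrite !ffunE.
  by rewrite odeg_ocons !opartial_ocons; exact: fom.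
rewrite le_eqVlt; apply/orP; left; apply/eqP; congr (`|_ - _|).
rewrite big_ocons -big_split /=; apply: eq_bigr => l _.
rewrite big_mkcond [X in _ + X]big_mkcond -big_split /=.
apply: eq_bigr => j _.
rewrite /taylor_term odeg_ocons omono_ocons opartial_ocons.
have mixed : mixed_point p q coords = q.
  by apply: coord_ext => o; rewrite coord_mixed mem_coords.
rewrite mixed; case: (ltngtP (l + mdeg j) N) => _; rewrite ?addr0 ?add0r//; ring.
Qed.

(** The two bounds on the entries of a multi-index select the same terms as
    soon as the total degree is at most [n]. *)
Lemma widen_multi_index n (G : nat -> ('I_d -> nat) -> R) :
  \sum_(l < n.+1) \sum_(j : {ffun 'I_d -> 'I_n.+1} | (l + mdeg j <= n)%N)
    G l (fun i => j i : nat) =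
  \sum_(l < n.+2) \sum_(j : {ffun 'I_d -> 'I_n.+2} | (l + mdeg j <= n)%N)
    G l (fun i => j i : nat).
Proof.
rewrite [RHS]big_ord_recr /= [X in _ + X]big_pred0 ?addr0 => [|j]; last first.
  by rewrite addSn ltnNge leq_addr.
apply: eq_bigr => l _.
pose up (j : {ffun 'I_d -> 'I_n.+1}) : {ffun 'I_d -> 'I_n.+2} :=
  [ffun i => widen_ord (leqnSn _) (j i)].
pose down (j : {ffun 'I_d -> 'I_n.+2}) : {ffun 'I_d -> 'I_n.+1} := [ffun i => inord (j i)].
rewrite [RHS](reindex_onto up down) => [|j /= jn].
  apply: eq_big => [j|j _].
    have -> : down (up j) = j.
      by apply/ffunP => i; rewrite !ffunE; apply/val_inj; rewrite /= inordK.
    rewrite eqxx andbT; congr (_ + _ <= _)%N.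
    by apply: eq_bigr => i _; rewrite ffunE.
  by congr (G _ _); apply/funext => i; rewrite ffunE.
apply/ffunP => i; rewrite !ffunE; apply/val_inj; rewrite /= inordK//.
rewrite ltnS (leq_trans _ jn)// (leq_trans _ (leq_addl _ _))//.
by rewrite /mdeg (bigD1 i)//= leq_addr.
Qed.

End hermite_taylor.

(** * Integrals of continuous functions over boxes *)

Lemma continuous_pair {X Y Z : topologicalType} (f : X -> Y) (g : X -> Z) :
  continuous f -> continuous g -> continuous (fun t => (f t, g t)).
Proof. by move=> cf cg t; exact: (cvg_pair (cf t) (cg t)). Qed.

Section segment_integral.
Context {R : realType}.
Local Notation mu := (@lebesgue_measure R).
Implicit Types (a b x B k : R) (g h : R -> R).

Lemma continuous_integrable_itv g a b : continuous g ->
  mu.-integrable `[a, b] (EFin \o g).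
Proof.
move=> cg; apply: continuous_compact_integrable; first exact: segment_compact.
exact: continuous_subspaceT.
Qed.

Lemma itv_integral_bound g a b B : a <= b -> continuous g ->
  (forall s, a <= s <= b -> `|g s| <= B) ->
  `|\int[mu]_(s in `[a, b]) g s| <= B * (b - a).
Proof.
move=> ab cg gB; apply: le_trans (le_normr_Rintegral _ _) _ => //.
  exact: continuous_integrable_itv.
have cB : continuous (fun _ : R => B : R) by move=> ?; exact: cst_continuous.
apply: (@le_trans _ _ (\int[mu]_(s in `[a, b]) B)).
  apply: le_Rintegral => //.
  - apply: continuous_integrable_itv => s.
    by apply: continuous_comp (cg s) _; exact: norm_continuous.
  - exact: continuous_integrable_itv.
rewrite Rintegral_cst//= lebesgue_measure_itv /= lte_fin.
move: ab; case: (ltgtP a b) => /= [ab _|_|-> _]; rewrite ?subrr ?mulr0 -?EFinB //.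
Qed.

(** The integrand varies uniformly little over the compact segment when the
    parameter moves little. The parameter space is arbitrary because it collects
    all outer variables of an iterated integral. *)
Lemma itv_integral_continuous (T : topologicalType) (H : T * R -> R) a b :
  a <= b -> continuous H ->
  continuous (fun t => \int[mu]_(s in `[a, b]) H (t, s)).
Proof.
move=> ab cH t0; apply/cvgrPdist_le => e e0.
have cHt t : continuous (fun s => H (t, s)).
  move=> s; apply: (@continuous_comp _ _ _ (fun s => (t, s)) H); last exact: cH.
  by apply: (@continuous_pair _ _ _ (fun=> t) id) => ?; [exact: cst_continuous|exact: cvg_id].
pose e' := e / (b - a + 1).
have ba1 : 0 < b - a + 1 by rewrite ltr_wpDl ?subr_ge0.
have e'0 : 0 < e' by rewrite divr_gt0.
have := @segment_compact R a b; rewrite compact_near_coveringP.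
move=> /(_ T (nbhs t0) (fun t s => `|H (t0, s) - H (t, s)| <= e') _) near_all.
have {}near_all : \forall t \near t0, `[a, b]%classic `<=` (fun s => `|H (t0, s) - H (t, s)| <= e').
  apply: near_all => s0 _.
  have /cvgrPdist_lt/(_ (e' / 2)) : H z @[z --> (t0, s0)] --> H (t0, s0) := cH (t0, s0).
  rewrite divr_gt0// => /(_ isT) Hnear.
  have /cvgrPdist_lt/(_ (e' / 2)) : H (t0, s0') @[s0' --> s0] --> H (t0, s0) := cHt t0 s0.
  rewrite divr_gt0// => /(_ isT) Hnear'.
  case: Hnear => -[U V] [/= nU nV] UV.
  exists (V `&` [set s0' | `|H (t0, s0) - H (t0, s0')| < e' / 2], U) => /=.
    by split=> //; exact: filterI.
  move=> [s0' t] /= [[Vs' Hs'] Ut]; have := UV (t, s0') (conj Ut Vs') => /= Hts.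
  have -> : H (t0, s0') - H (t, s0') =
     (H (t0, s0) - H (t, s0')) - (H (t0, s0) - H (t0, s0')) by ring.
  by rewrite (le_trans (ler_normB _ _))// [leRHS]splitr lerD// ltW.
near=> t.
rewrite -RintegralB//; [|exact: continuous_integrable_itv..].
apply: (@le_trans _ _ (e' * (b - a))).
  apply: itv_integral_bound => //.
    by move=> s; apply: continuousB; exact: cHt.
  move=> s sab; apply: (near near_all t)  => //.
by rewrite /e' mulrAC ler_pdivrMr// ler_wpM2l ?ltW// ltrDl.
Unshelve. all: by end_near. Qed.

Lemma itv_integral_monomial a b x l : a < b ->
  \int[mu]_(u in `[a, b]) (u - x) ^+ l =
  ((b - x) ^+ l.+1 - (a - x) ^+ l.+1) / l.+1%:R.
Proof.
move=> ab; pose F (u : R) := (u - x) ^+ l.+1 / l.+1%:R.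
have dF (u : R) : is_derive u 1 F ((u - x) ^+ l).
  have d0 : is_derive u 1 (fun s => s - x : R) 1.
    exact: (is_derive_shift u 1 (- x)).
  have dp : is_derive u 1 (fun s => (s - x) ^+ l.+1) (l.+1%:R * (u - x) ^+ l * 1).
    have -> : (fun s => (s - x) ^+ l.+1) = (fun s => s - x : R) ^+ l.+1.
      by apply/funext => s; rewrite exprfctE.
    exact: is_deriveX.
  have dc : is_derive u 1 (fun _ : R => l.+1%:R^-1 : R) 0 by exact: is_derive_cst.
  have := is_derive_mul _ _ _ _ _ dp dc.
  by congr is_derive; rewrite mulr0 add0r mulr1 mulKf.
have cF : continuous F.
  by move=> u; apply/differentiable_continuous/derivable1_diffP/ex_derive.
have cf : continuous (fun u : R => (u - x) ^+ l).
  move=> u; apply: (@continuous_comp _ _ _ (fun u : R => u - x) (fun v => v ^+ l)).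
    by apply: continuousB => //; exact: cst_continuous.
  exact: exprn_continuous.
rewrite /Rintegral (@continuous_FTC2 _ _ F)//.
- by rewrite -EFinB /= /F mulrBl.
- exact: continuous_subspaceT.
- split=> [u _|  |]; first exact: ex_derive.
  + exact/cvg_at_right_filter/cF.
  + exact/cvg_at_left_filter/cF.
- by move=> u _; rewrite derive1E; exact: derive_val.
Qed.

End segment_integral.

Lemma continuous_mx {X T : topologicalType} m n (M : X -> 'M[T]_(m, n)) :
  (forall i j, continuous (fun t => M t i j)) -> continuous M.
Proof.
move=> cM t A [P MP PA]; apply: (@filterS _ (nbhs t) _ (fun s => forall i j, P i j (M s i j))).
  by move=> s Ps; apply: PA.
by apply: filter_forall => i; apply: filter_forall => j; exact: (cM i j t _ (MP i j)).
Qed.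

Section box_integrals.
Context {R : realType}.
Local Notation mu := (@lebesgue_measure R).

Definition box {d} (a b : 'I_d -> R) (i : 'I_d) : set R := `[a i, b i]%classic.

Definition glue {d} (t : R) (v : 'rV[R]_d) : 'rV[R]_d.+1 := row_mx (t%:M : 'rV[R]_1) v.

Lemma glue_continuous d : continuous (fun tv : R * 'rV[R]_d => glue tv.1 tv.2).
Proof.
apply: continuous_mx => i j; rewrite (ord1 i); case: (unliftP ord0 j) => [j'|] ->.
  have -> : (fun tv : R * 'rV[R]_d => glue tv.1 tv.2 0 (lift ord0 j')) = (fun tv => tv.2 0 j').
    by apply/funext => tv; rewrite row_mx_lift.
  move=> tv; apply: (@continuous_comp _ _ _ snd (fun v : 'rV[R]_d => v 0 j')).
    exact: cvg_snd.
  exact: coord_continuous.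
have -> : (fun tv : R * 'rV[R]_d => glue tv.1 tv.2 0 ord0) = fst.
  by apply/funext => tv; rewrite row_mx_ord0 mxE eqxx.
by move=> tv; exact: cvg_fst.
Qed.

Lemma box_integral_continuous (T : topologicalType) d (a b : 'I_d -> R)
    (G : T * 'rV[R]_d -> R) : (forall i, a i <= b i) -> continuous G ->
  continuous (fun t => box_integral (box a b) (fun v => G (t, v))).
Proof.
elim: d T a b G => [|d IH] T a b G ab cG.
  move=> t /=; apply: (@continuous_comp T _ _ (fun t : T => (t, 0 : 'rV[R]_0)) G); last exact: cG.
  by apply: (@continuous_pair T T _ id (fun=> 0 : 'rV[R]_0)) => ?;
    [exact: cvg_id|exact: cst_continuous].
apply: (@itv_integral_continuous _ T (fun ts =>
  box_integral (fun i => box a b (lift ord0 i)) (fun v => G (ts.1, glue ts.2 v)))) => //.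
apply: (@IH (T * R)%type (fun i => a (lift ord0 i)) (fun i => b (lift ord0 i))
  (fun tsv => G (tsv.1.1, glue tsv.1.2 tsv.2))) => // tsv.
apply: (@continuous_comp _ _ _ (fun tsv => (tsv.1.1, glue tsv.1.2 tsv.2)) G); last exact: cG.
apply: (@continuous_pair _ _ _ (fun tsv => tsv.1.1) (fun tsv => glue tsv.1.2 tsv.2)) => {}tsv.
  by apply: (@continuous_comp _ _ _ fst fst); exact: cvg_fst.
apply: (@continuous_comp _ _ _ (fun tsv : T * R * 'rV[R]_d => (tsv.1.2, tsv.2))
   (fun tv => glue tv.1 tv.2)); last exact: glue_continuous.
apply: (@continuous_pair _ _ _ (fun tsv => tsv.1.2) snd) => {}tsv; last exact: cvg_snd.
by apply: (@continuous_comp _ _ _ fst snd); [exact: cvg_fst|exact: cvg_snd].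
Qed.

Lemma glue_continuous_r d (g : 'rV[R]_d.+1 -> R) t :
  continuous g -> continuous (fun v => g (glue t v)).
Proof.
move=> cg v; apply: (@continuous_comp _ _ _ (glue t) g); last exact: cg.
apply: (@continuous_comp _ _ _ (fun v => (t, v)) (fun tv => glue tv.1 tv.2)).
  by apply: (@continuous_pair _ _ _ (fun=> t) id) => ?; [exact: cst_continuous|exact: cvg_id].
exact: glue_continuous.
Qed.

(** Continuity of the inner integrals is what makes the outer one integrable,
    hence additive. *)
Lemma inner_box_integral_continuous d (a b : 'I_d.+1 -> R) (g : 'rV[R]_d.+1 -> R) :
  (forall i, a i <= b i) -> continuous g ->
  continuous (fun t => box_integral (fun i => box a b (lift ord0 i)) (fun v => g (glue t v))).
Proof.
move=> ab cg; apply: (@box_integral_continuous R d (fun i => a (lift ord0 i))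
  (fun i => b (lift ord0 i)) (fun tv => g (glue tv.1 tv.2))) => // tv.
by apply: (@continuous_comp _ _ _ (fun tv => glue tv.1 tv.2) g);
  [exact: glue_continuous|exact: cg].
Qed.

Lemma box_integralD d (a b : 'I_d -> R) (g h : 'rV[R]_d -> R) :
  (forall i, a i <= b i) -> continuous g -> continuous h ->
  box_integral (box a b) (fun v => g v + h v) =
  box_integral (box a b) g + box_integral (box a b) h.
Proof.
elim: d a b g h => [//|d IH] a b g h ab cg ch /=.
rewrite -RintegralD; [|exact: measurable_itv|..];
  do ?by apply: continuous_integrable_itv; exact: inner_box_integral_continuous.
congr Rintegral; apply/funext => t.
rewrite -(IH (fun i => a (lift ord0 i)) (fun i => b (lift ord0 i)))//;
  exact: glue_continuous_r.
Qed.

Lemma box_integralZ d (a b : 'I_d -> R) k (g : 'rV[R]_d -> R) :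
  (forall i, a i <= b i) -> continuous g ->
  box_integral (box a b) (fun v => k * g v) = k * box_integral (box a b) g.
Proof.
elim: d a b g => [//|d IH] a b g ab cg /=.
rewrite -RintegralZl; [|exact: measurable_itv|]; last first.
  by apply: continuous_integrable_itv; exact: inner_box_integral_continuous.
congr Rintegral; apply/funext => t.
rewrite -(IH (fun i => a (lift ord0 i)) (fun i => b (lift ord0 i)))//;
  exact: glue_continuous_r.
Qed.

Lemma box_integral_bound d (a b : 'I_d -> R) (B : R) (g : 'rV[R]_d -> R) :
  (forall i, a i <= b i) -> continuous g ->
  (forall v : 'rV[R]_d, (forall i, a i <= v 0 i <= b i) -> `|g v| <= B) ->
  `|box_integral (box a b) g| <= B * \prod_i (b i - a i).
Proof.
elim: d a b g => [|d IH] a b g ab cg gB /=.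
  by rewrite big_ord0 mulr1; apply: gB => -[].
rewrite big_ord_recl (mulrC (b ord0 - _)) mulrA.
apply: itv_integral_bound => //; first exact: inner_box_integral_continuous.
move=> s sab; apply: (IH (fun i => a (lift ord0 i)) (fun i => b (lift ord0 i))) => //.
  exact: glue_continuous_r.
move=> v vab; apply: gB => i; case: (unliftP ord0 i) => [i'|] ->.
  by rewrite row_mx_lift.
by rewrite row_mx_ord0 mxE eqxx.
Qed.

Lemma continuous_coord_prod d (g : 'I_d -> R -> R) : (forall i, continuous (g i)) ->
  continuous (fun v : 'rV[R]_d => \prod_i g i (v 0 i)).
Proof.
move=> cg; apply: continuous_big => [|i _ v]; first exact: mul_continuous.
apply: (@continuous_comp _ _ _ (fun v : 'rV[R]_d => v 0 i) (g i)); last exact: cg.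
exact: coord_continuous.
Qed.

Lemma box_integral_prod d (a b : 'I_d -> R) (g : 'I_d -> R -> R) :
  (forall i, a i <= b i) -> (forall i, continuous (g i)) ->
  box_integral (box a b) (fun v => \prod_i g i (v 0 i)) =
  \prod_i \int[mu]_(s in `[a i, b i]) g i s.
Proof.
elim: d a b g => [|d IH] a b g ab cg /=; first by rewrite !big_ord0.
rewrite big_ord_recl -(IH (fun i => a (lift ord0 i)) (fun i => b (lift ord0 i))
  (fun i => g (lift ord0 i)))// -RintegralZr//; last exact: continuous_integrable_itv.
congr Rintegral; apply/funext => t.
rewrite -(box_integralZ _ (fun i => a (lift ord0 i)) (fun i => b (lift ord0 i)))//; last first.
  exact: (continuous_coord_prod _ (fun i => g (lift ord0 i))).
congr (box_integral _ _); apply/funext => v.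
rewrite big_ord_recl row_mx_ord0 mxE eqxx; congr (_ * _).
by apply: eq_bigr => i _; rewrite row_mx_lift.
Qed.

End box_integrals.

(** * Means over cells *)

Section cell_means.
Context {R : realType} {d : nat}.
Local Notation mu := (@lebesgue_measure R).
Implicit Types (F G : R * 'rV[R]_d -> R) (w B c : R) (k : int) (m : 'rV[int]_d).

Definition cell_mean w k m F : R :=
  w ^+ d.+1 * \int[mu]_(u in cell w k)
    box_integral (fun i => cell w (m 0 i)) (fun v => F (u, v)).

Let lo w m i : R := (m 0 i)%:~R / w.
Let hi w m i : R := ((m 0 i)%:~R + 1) / w.

Let lohi w m i : 0 < w -> lo w m i <= hi w m i.
Proof. by move=> w0; rewrite ler_pM2r ?invr_gt0// lerDl. Qed.

Let inner_continuous w m F : 0 < w -> continuous F ->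
  continuous (fun u => box_integral (fun i => cell w (m 0 i)) (fun v => F (u, v))).
Proof.
move=> w0 cF; apply: (@box_integral_continuous R R d (lo w m) (hi w m)) => // i.
exact: lohi.
Qed.

Let slice_continuous F (u : R) : continuous F -> continuous (fun v => F (u, v)).
Proof.
move=> cF v; apply: (@continuous_comp _ _ _ (fun v => (u, v)) F); last exact: cF.
by apply: (@continuous_pair _ _ _ (fun=> u) id) => ?; [exact: cst_continuous|exact: cvg_id].
Qed.

Lemma cell_meanD w k m F G : 0 < w -> continuous F -> continuous G ->
  cell_mean w k m (fun q => F q + G q) = cell_mean w k m F + cell_mean w k m G.
Proof.
move=> w0 cF cG; rewrite /cell_mean -mulrDr -RintegralD; [|exact: measurable_itv|..];
  do ?by apply: continuous_integrable_itv; exact: inner_continuous.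
congr (_ * Rintegral _ _ _); apply/funext => u.
by apply: (@box_integralD R d (lo w m) (hi w m)) => [i||];
  [exact: lohi|exact: slice_continuous..].
Qed.

Lemma cell_meanZ w k m c F : 0 < w -> continuous F ->
  cell_mean w k m (fun q => c * F q) = c * cell_mean w k m F.
Proof.
move=> w0 cF; rewrite /cell_mean mulrCA; congr (_ * _).
rewrite -RintegralZl; [|exact: measurable_itv|]; last first.
  by apply: continuous_integrable_itv; exact: inner_continuous.
congr Rintegral; apply/funext => u.
by apply: (@box_integralZ R d (lo w m) (hi w m)) => [i|];
  [exact: lohi|exact: slice_continuous].
Qed.

Lemma cell_mean_sum w k m (I : Type) (r : seq I) (P : pred I) (c : I -> R)
    (F : I -> R * 'rV[R]_d -> R) : 0 < w -> (forall i, P i -> continuous (F i)) ->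
  cell_mean w k m (fun q => \sum_(i <- r | P i) c i * F i q) =
  \sum_(i <- r | P i) c i * cell_mean w k m (F i).
Proof.
move=> w0 cF; elim: r => [|i r IH].
  rewrite big_nil; under eq_fun do rewrite big_nil -(mul0r (1 : R)).
  by rewrite cell_meanZ ?mul0r// => q; exact: cst_continuous.
rewrite big_cons; under eq_fun do rewrite big_cons.
case: ifPn => Pi; last exact: IH.
have cZ i' : P i' -> continuous (fun q => c i' * F i' q).
  by move=> Pi' q; apply: cvgM; [exact: cvg_cst|exact: cF].
rewrite cell_meanD ?cell_meanZ ?IH//; [exact: cF|exact: cZ|].
by apply: continuous_big => //; exact: add_continuous.
Qed.

Lemma cell_mean_bound w k m F B : 0 < w -> continuous F ->
  (forall u (v : 'rV[R]_d), cell w k u -> (forall i, cell w (m 0 i) (v 0 i)) -> `|F (u, v)| <= B) ->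
  `|cell_mean w k m F| <= B.
Proof.
move=> w0 cF FB; have len (t : R) : (t + 1) / w - t / w = w^-1 by field; rewrite gt_eqF.
rewrite /cell_mean normrM ger0_norm ?exprn_ge0 ?(ltW w0)//.
have bd u : k%:~R / w <= u <= (k%:~R + 1) / w ->
    `|box_integral (fun i => cell w (m 0 i)) (fun v => F (u, v))| <= B * w^-1 ^+ d.
  move=> uk; apply: le_trans (@box_integral_bound R d (lo w m) (hi w m) B _ _ _ _) _.
  - by move=> i; exact: lohi.
  - exact: slice_continuous.
  - by move=> v vm; apply: FB => [|i]; rewrite /cell /= in_itv//=; exact: vm.
  under eq_bigr do rewrite /hi /lo len.
  by rewrite prodr_const card_ord.
have := @itv_integral_bound R _ (k%:~R / w) ((k%:~R + 1) / w) _ _ _ bd.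
rewrite len => /(_ _ _)/= bd'.
rewrite [leLHS]mulrC -ler_pdivlMr ?exprn_gt0// -exprVn exprS (mulrC w^-1) mulrA.
apply: bd'; last exact: inner_continuous.
by rewrite ler_pM2r ?invr_gt0// lerDl.
Qed.

(** [\int_0^1 (a + s) ^+ l ds], expanded in powers of [a]. *)
Definition mean_pow (l : nat) (a : R) : R :=
  \sum_(c < l.+1) 'C(l, c)%:R / (l - c + 1)%:R * a ^+ c.

Lemma mean_powE l (a : R) : mean_pow l a = ((a + 1) ^+ l.+1 - a ^+ l.+1) / l.+1%:R.
Proof.
rewrite (addrC a) exprDn big_ord_recr /= subnn expr0 binn mulr1n mul1r addrK mulr_suml.
apply: eq_bigr => c _; rewrite expr1n mul1r -mulr_natl.
have cl : (c <= l)%N by rewrite -ltnS.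
have l1 : (l.+1 - c = l - c + 1)%N by rewrite subSn// addn1.
have := mul_bin_down l.+1 c; rewrite /= l1 => /(congr1 (fun n => n%:R : R)).
rewrite !natrM => e.
have l0 : l.+1%:R != 0 :> R by [].
have lc0 : (l - c + 1)%:R != 0 :> R by rewrite addn1.
have -> : 'C(l, c)%:R = (l - c + 1)%:R * 'C(l.+1, c)%:R / l.+1%:R :> R.
  by rewrite -e mulrC mulKf.
by field; apply/andP.
Qed.

Lemma cell_monomial w k x l : 0 < w ->
  w ^+ l.+1 * \int[mu]_(u in cell w k) (u - x) ^+ l = mean_pow l (k%:~R - w * x).
Proof.
move=> w0; have wn0 : w != 0 by rewrite gt_eqF.
rewrite itv_integral_monomial ?ltr_pM2r ?invr_gt0 ?ltrDl// mean_powE mulrA mulrBr.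
rewrite -!exprMn; congr ((_ ^+ _ - _ ^+ _) / _); field; exact: wn0.
Qed.

Lemma cell_mean_monomial w k m x (y : 'rV[R]_d) N l (j : {ffun 'I_d -> 'I_N}) : 0 < w ->
  w ^+ (l + mdeg j) * cell_mean w k m (fun q => (q.1 - x) ^+ l * mpow (q.2 - y) j) =
  mean_pow l (k%:~R - w * x) *
    \prod_i mean_pow (j i) ((m 0 i)%:~R - w * y 0 i).
Proof.
move=> w0.
have cp (z : R) e : continuous (fun u : R => (u - z) ^+ e).
  move=> u; apply: (@continuous_comp _ _ _ (fun u : R => u - z) (fun v => v ^+ e)).
    by apply: continuousB => //; exact: cst_continuous.
  exact: exprn_continuous.
rewrite /cell_mean /=.
have inner u : box_integral (fun i => cell w (m 0 i))
     (fun v => (u - x) ^+ l * mpow (v - y) j) =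
   (u - x) ^+ l * \prod_i \int[mu]_(s in cell w (m 0 i)) (s - y 0 i) ^+ j i.
  rewrite -(@box_integral_prod R d (lo w m) (hi w m) (fun i s => (s - y 0 i) ^+ j i)) => [|i|i];
    [|exact: lohi|exact: cp].
  rewrite -(@box_integralZ R d (lo w m) (hi w m)) => [|i|]; [|exact: lohi|].
    congr (box_integral _ _); apply/funext => v; congr (_ * _).
    by apply: eq_bigr => i _; rewrite !mxE.
  exact: (@continuous_coord_prod R d (fun i s => (s - y 0 i) ^+ j i)).
under eq_Rintegral => u _ do rewrite inner.
rewrite RintegralZr; [|exact: measurable_itv|exact: continuous_integrable_itv].
rewrite -cell_monomial//.
under [in RHS]eq_bigr => i _ do rewrite -cell_monomial//.
rewrite big_split /=.
have -> : \prod_i w ^+ (j i).+1 = w ^+ mdeg j * w ^+ d.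
  rewrite /mdeg -prodrXr; under eq_bigr do rewrite exprS mulrC.
  by rewrite big_split /= prodr_const card_ord.
by rewrite exprD !exprS; ring.
Qed.

Lemma cell_mean1 w k m : 0 < w -> cell_mean w k m (fun=> 1) = 1.
Proof.
move=> w0.
have pow0 a : mean_pow 0 a = 1.
  by rewrite /mean_pow big_ord_recl big_ord0 addr0 expr0 mulr1 bin0 divr1.
have := @cell_mean_monomial w k m 0 0 1 0 [ffun=> ord0] w0.
rewrite /mdeg big1 => [|i _]; last by rewrite ffunE.
rewrite expr0 mul1r pow0 mul1r big1 => [mean1|i _]; last by rewrite ffunE pow0.
rewrite -[RHS]mean1.
congr cell_mean; apply/funext => q; rewrite expr0 mul1r /mpow big1// => i _.
by rewrite ffunE expr0.
Qed.

End cell_means.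

(** * Discrete moments of a kernel *)

Section kernel.
Context {R : realType} {N : nat} {chi : R -> R}.
Context (hchi : kernel_of_order N chi).
Implicit Types (u r : R) (k : int).

Lemma abs_moment_bound (r : nat) : (r <= N)%N -> exists A, forall u,
  exists2 B, nneg_sum (fun k => `|u - k%:~R| ^+ r * `|chi (u - k%:~R)|) B & B <= A.
Proof.
move=> rN; have [_ _ _ /(_ r%:R)] := hchi; rewrite ler0n ler_nat => /(_ rN) moo.
have esum_le u : (\esum_(k in [set: int]) (`|u - k%:~R| ^+ r * `|chi (u - k%:~R)|)%:E
    <= abs_moment r%:R chi)%E.
  apply: ereal_sup_ubound; exists u => //; apply: eq_esum => k _.
  by rewrite powR_mulrn.
have m0 : (0 <= abs_moment r%:R chi)%E.
  apply: le_trans (esum_le 0); apply: esum_ge0 => k _.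
  by rewrite lee_fin mulr_ge0 ?exprn_ge0.
exists (fine (abs_moment r%:R chi)) => u; apply: nneg_sum_exists => [k|].
  by rewrite mulr_ge0 ?exprn_ge0.
by rewrite fineK ?esum_le// ge0_fin_numE.
Qed.

Lemma kernel_abs_sum : exists A, forall u,
  exists2 B, nneg_sum (fun k => `|chi (u - k%:~R)|) B & B <= A.
Proof.
have [A hA] := abs_moment_bound 0 (leq0n _); exists A => u.
have [B hB BA] := hA u; exists B => //; move: hB; congr nneg_sum.
by apply/funext => k; rewrite expr0 mul1r.
Qed.

Lemma exprD1_le (t : R) : 0 <= t -> (t + 1) ^+ N <= 2 ^+ N * (t ^+ N + 1).
Proof.
move=> t0; have [t1|t1] := leP t 1.
  apply: (@le_trans _ _ (2 ^+ N)).
    by rewrite lerXn2r ?nnegrE ?addr_ge0//; lra.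
  by rewrite ler_peMr ?exprn_ge0// lerDr exprn_ge0.
apply: (@le_trans _ _ (2 ^+ N * t ^+ N)).
  by rewrite -exprMn lerXn2r ?nnegrE ?addr_ge0 ?mulr_ge0//; lra.
by rewrite ler_wpM2l ?exprn_ge0// lerDl.
Qed.

Lemma kernel_shifted_moment : exists A, forall u,
  exists2 B, nneg_sum (fun k => `|chi (u - k%:~R)| * (`|u - k%:~R| + 1) ^+ N) B & B <= A.
Proof.
have [A hA] := abs_moment_bound N (leqnn _).
have [A' hA'] := kernel_abs_sum.
exists (2 ^+ N * (A + A')) => u.
have [B hB BA] := hA u; have [B' hB' BA'] := hA' u.
have p2 : 0 <= 2 ^+ N :> R by rewrite exprn_ge0.
have [k|C hC CB] := @nneg_sum_le _ _
  (fun k : int => `|chi (u - k%:~R)| * (`|u - k%:~R| + 1) ^+ N) _ _ _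
  (nneg_sumZ _ _ _ p2 (nneg_sumD _ _ _ _ hB hB')); last first.
  by exists C => //; rewrite (le_trans CB)// ler_wpM2l// lerD.
rewrite mulr_ge0 ?exprn_ge0 ?addr_ge0//= mulrC.
have -> : `|u - k%:~R| ^+ N * `|chi (u - k%:~R)| + `|chi (u - k%:~R)| =
  (`|u - k%:~R| ^+ N + 1) * `|chi (u - k%:~R)| by ring.
by rewrite mulrA ler_wpM2r// exprD1_le.
Qed.

(** For [r >= 2] the condition [r <= |u - k| + 1] forces [|u - k| >= 1], so that
    [(|u - k| + 1) ^ N] is at most [2 ^ N * |u - k| ^ N] and the uniform convergence
    required of a kernel applies. *)
Lemma kernel_tail (eta : R) : 0 < eta -> exists r0, forall r, r0 <= r -> forall u,
  exists2 B, nneg_sum (fun k => `|chi (u - k%:~R)| * (`|u - k%:~R| + 1) ^+ N *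
    (r <= `|u - k%:~R| + 1)%R%:R) B & B <= eta.
Proof.
move=> eta0; have [_ _ tail0 _] := hchi.
have p2 : 0 < 2 ^+ N :> R by rewrite exprn_gt0.
have eta'0 : 0 < eta / 2 ^+ N by rewrite divr_gt0.
pose tail r : \bar R := ereal_sup (range (fun u =>
  \esum_(k in [set k : int | r <= `|u - k%:~R|])
    (`|u - k%:~R| ^+ N * `|chi (u - k%:~R)|)%:E)).
have {}tail0 : tail r @[r --> (+oo : set_system R)] --> 0%E := tail0.
move: tail0 => /fine_cvgP[tail_fin /cvgrPdist_lt/(_ _ eta'0) tail_small].
have [r1 [_ r1P]] : \forall r \near (+oo : set_system R), (tail r <= (eta / 2 ^+ N)%:E)%E.
  near=> r.
  have fr : tail r \is a fin_num by near: r.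
  rewrite -(fineK fr) lee_fin ltW// (le_lt_trans (ler_norm _))//.
  by rewrite -normrN -sub0r; near: r.
(* The tail bound is used at [r - 1], which has to exceed [r1]. *)
exists (Num.max 2 (r1 + 2)) => r; rewrite ge_max => /andP[r2 r1r] u.
have {r1P} := r1P (r - 1); rewrite ltrBrDr (lt_le_trans _ r1r) ?ltrD2l ?ltr1n// => /(_ isT).
move=> /(le_trans (ereal_sup_ubound _)) => sup_le.
pose far := [set k : int | r - 1 <= `|u - k%:~R|].
have esum_le : (\esum_(k in far)
    (`|u - k%:~R| ^+ N * `|chi (u - k%:~R)|)%:E <= (eta / 2 ^+ N)%:E)%E.
  by apply: sup_le; exists u.
have := @nneg_sum_exists _ _ (fun k : int => `|u - k%:~R| ^+ N * `|chi (u - k%:~R)| *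
   (r - 1 <= `|u - k%:~R|)%R%:R) (eta / 2 ^+ N).
case=> [k||B hB Beta].
- by rewrite !mulr_ge0 ?exprn_ge0.
- apply: le_trans esum_le; rewrite [leRHS]esum_mkcond; apply: le_esum => k _.
  have [rk|/negP rk] := boolP (r - 1 <= `|u - k%:~R|); last first.
    by rewrite mulr0 memNset.
  by rewrite mulr1 mem_set.
have [k|C hC CB] := @nneg_sum_le _ _
  (fun k : int => `|chi (u - k%:~R)| * (`|u - k%:~R| + 1) ^+ N *
    (r <= `|u - k%:~R| + 1)%R%:R) _ _ _ (nneg_sumZ _ _ _ (ltW p2) hB); last first.
  by exists C => //; rewrite (le_trans CB)// mulrC -ler_pdivlMr.
rewrite !mulr_ge0 ?exprn_ge0 ?addr_ge0//= lerBlDr.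
case: (leP r _) => [rk|_]; rewrite ?mulr0// !mulr1 (mulrC `|chi _|) mulrA ler_wpM2r//.
rewrite -exprMn lerXn2r ?nnegrE ?addr_ge0 ?mulr_ge0//.
by rewrite mulr_natl mulr2n lerD2l; lra.
Unshelve. all: by end_near. Qed.

(** Up to the factor [hermite_const], the majorant of the rescaled error on a
    cell at rescaled distance [tau]: [eps] bounds the oscillation of the top
    derivatives near the point, and [M] bounds it everywhere. *)
Definition weight (eps M r tau : R) : R := tau ^+ N * (eps + M * (r <= tau)%R%:R).

(** The near part is small because of the factor [eps] and the far part because
    of [kernel_tail], applied with a threshold small enough to absorb [M]. *)
Lemma kernel_weight : exists2 A, 0 <= A &
  (forall u, exists2 B, nneg_sum (fun k => `|chi (u - k%:~R)|) B & B <= A) /\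
  (forall eps M, 0 < eps -> 0 <= M -> exists r0, forall r, r0 <= r -> forall u,
    exists2 B, nneg_sum (fun k => `|chi (u - k%:~R)| *
      weight eps M r (`|u - k%:~R| + 1)) B & B <= A * eps).
Proof.
have [A1 hA1] := kernel_abs_sum; have [A2 hA2] := kernel_shifted_moment.
have A10 : 0 <= A1.
  by have [B hB] := hA1 0; apply: le_trans; exact: nneg_sum_ge0 hB.
have A20 : 0 <= A2.
  by have [B hB] := hA2 0; apply: le_trans; exact: nneg_sum_ge0 hB.
exists (A1 + A2 + 1); first by rewrite !addr_ge0.
split=> [u|eps M e0 M0].
  have [B hB BA] := hA1 u; exists B => //; rewrite (le_trans BA)//.
  by rewrite -addrA lerDl addr_ge0.
have M1 : 0 < M + 1 by rewrite ltr_wpDl.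
have [r0 hr0] := kernel_tail (eps / (M + 1)) (divr_gt0 e0 M1).
exists r0 => r /hr0 {}hr0 u.
have [B hB BA] := hr0 u; have [B' hB' BA'] := hA2 u.
exists (eps * B' + M * B).
  have := nneg_sumD _ _ _ _ (nneg_sumZ _ _ _ (ltW e0) hB') (nneg_sumZ _ _ _ M0 hB).
  by congr nneg_sum; apply/funext => k; rewrite /weight; ring.
have MB : M * B <= eps.
  apply: (@le_trans _ _ (M * (eps / (M + 1)))); first by rewrite ler_wpM2l.
  by rewrite mulrCA ler_piMr ?(ltW e0)// ler_pdivrMr// mul1r lerDl.
have : eps * B' <= A2 * eps by rewrite mulrC ler_wpM2r// ltW.
have : 0 <= A1 * eps by rewrite mulr_ge0// ltW.
by move: MB; lra.
Qed.

Context (mchi : nat -> R).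
Context (hmchi : forall r : nat, (r <= N)%N -> forall u, moment r chi u = mchi r).

Lemma has_asum_kernel u : has_asum (fun k => chi (u - k%:~R)) 1.
Proof.
have [A hA] := kernel_abs_sum; have [B hB _] := hA u.
have [//|s hs _] := has_asum_le (fun k : int => chi (u - k%:~R)) _ B _ hB.
have [asum1 _ _ _] := hchi.
have s1 : s = 1 by rewrite -(asum1 u) -(has_asumE _ _ hs).
by move: hs; rewrite s1.
Qed.

Lemma has_asum_moment (r : nat) u : (r <= N)%N ->
  has_asum (fun k => (k%:~R - u) ^+ r * chi (u - k%:~R)) (mchi r).
Proof.
move=> rN; have [A hA] := abs_moment_bound r rN; have [B hB _] := hA u.
have [|s hs _] := has_asum_le (fun k : int => (k%:~R - u) ^+ r * chi (u - k%:~R)) _ B _ hB.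
  by move=> k; rewrite normrM normrX distrC.
by rewrite -(hmchi r rN u) /moment (has_asumE _ _ hs).
Qed.

Lemma has_asum_mean_pow l u : (l <= N)%N ->
  has_asum (fun k => chi (u - k%:~R) * mean_pow l (k%:~R - u))
    (\sum_(c < l.+1) 'C(l, c)%:R / (l - c + 1)%:R * mchi c).
Proof.
move=> lN.
have hc (c : 'I_l.+1) : true -> has_asum (fun k : int => 'C(l, c)%:R / (l - c + 1)%:R *
     ((k%:~R - u) ^+ c * chi (u - k%:~R))) ('C(l, c)%:R / (l - c + 1)%:R * mchi c).
  by move=> _; apply/has_asumZ/has_asum_moment; rewrite (leq_trans _ lN)// -ltnS.
have := has_asum_sum _ (index_enum 'I_l.+1) xpredT _ _ hc.
apply: eq_has_asum => k.
by rewrite /mean_pow mulr_sumr; apply: eq_bigr => c _; ring.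
Qed.

End kernel.

(** * The error of the Hermite expansion *)

Section oscillation.
Context {R : realType} {d N : nat}.
Context {f : R * 'rV[R]_d -> R} (Cf : Cb N f) (p : R * 'rV[R]_d).
Local Notation idx := ('I_N.+1 * {ffun 'I_d -> 'I_N.+1})%type.

Lemma top_continuous (lj : idx) : (lj.1 + mdeg lj.2)%N = N ->
  continuous (mpartial lj.1 lj.2 f).
Proof.
by move=> ljN; apply: (@Cb_continuous _ _ (N - (lj.1 + mdeg lj.2)));
  apply: Cb_mpartial; rewrite ?ljN.
Qed.

Lemma top_near (eps : R) : 0 < eps -> exists2 delta, 0 < delta &
  forall lj : idx, (lj.1 + mdeg lj.2)%N = N ->
  forall z, (forall o, `|coord z o - coord p o| < delta) ->
    `|mpartial lj.1 lj.2 f z - mpartial lj.1 lj.2 f p| <= eps.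
Proof.
move=> e0.
have : \forall z \near p, forall lj : idx, (lj.1 + mdeg lj.2)%N = N ->
    `|mpartial lj.1 lj.2 f z - mpartial lj.1 lj.2 f p| <= eps.
  apply: (@filter_forall _ _ (fun (lj : idx) z => (lj.1 + mdeg lj.2)%N = N ->
    `|mpartial lj.1 lj.2 f z - mpartial lj.1 lj.2 f p| <= eps) _ (nbhs_filter p)) => lj.
  have [ljN|] := eqVneq (lj.1 + mdeg lj.2)%N N; last by move=> /eqP ljN; apply: nearW => z /ljN.
  have /cvgrPdist_le/(_ _ e0) := top_continuous lj ljN p.
  by apply: filterS => z + _; rewrite distrC.
move=> /nbhs_ballP[delta /= delta0 pdelta]; exists delta => // lj ljN z zp.
apply: pdelta ljN; split.
  by rewrite /ball /= distrC; exact: (zp None).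
by split=> // i j; rewrite /ball /= distrC (ord1 i); exact: (zp (Some j)).
Qed.

Lemma top_bound : exists2 M, 0 <= M &
  forall lj : idx, (lj.1 + mdeg lj.2)%N = N -> forall z,
    `|mpartial lj.1 lj.2 f z - mpartial lj.1 lj.2 f p| <= M.
Proof.
have /choice[M MP] (lj : idx) : exists M, (lj.1 + mdeg lj.2)%N = N ->
    forall z, `|mpartial lj.1 lj.2 f z| <= M.
  have [ljN|] := eqVneq (lj.1 + mdeg lj.2)%N N; last by move=> /eqP ljN; exists 0 => /ljN.
  have [|M MP] := @Cb_bounded R d (N - (lj.1 + mdeg lj.2)) (mpartial lj.1 lj.2 f).
    by apply: Cb_mpartial; rewrite ?ljN.
  by exists M.
exists (\sum_lj (`|M lj| + `|M lj|)); first by rewrite sumr_ge0// => lj _; rewrite addr_ge0.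
move=> lj ljN z; rewrite (bigD1 lj)//=.
apply: (@le_trans _ _ (`|M lj| + `|M lj|)); last first.
  by rewrite lerDl sumr_ge0// => lj' _; rewrite addr_ge0.
have MPz z' : `|mpartial lj.1 lj.2 f z'| <= `|M lj| := le_trans (MP lj ljN z') (ler_norm _).
by rewrite (le_trans (ler_normB _ _))// lerD.
Qed.

End oscillation.

Section cell_error.
Context {R : realType} {d : nat}.

(** A bound for the distance between [p] and a point of the cell [(k, m)] along the
    coordinate [o], in units of the side [1 / w]; the summand [1] accounts for the
    extent of the cell itself. *)
Definition cell_dist (w : R) (p : R * 'rV[R]_d) (k : int) (m : 'rV[int]_d)
    (o : option 'I_d) : R :=
  `|w * coord p o - (if o is Some i then m 0 i else k)%:~R| + 1.

Lemma cell_dist_ge0 w p k m o : 0 <= cell_dist w p k m o.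
Proof. by rewrite addr_ge0. Qed.

Lemma cell_distP (w t : R) (k : int) (c : R) : 0 < w -> cell w k c ->
  `|c - t| <= (`|w * t - k%:~R| + 1) / w.
Proof.
move=> w0; rewrite /cell /= in_itv /= => /andP[].
rewrite ler_pdivrMr// ler_pdivlMr// => kc ck.
rewrite ler_pdivlMr// -[X in _ * X](gtr0_norm w0) -normrM.
have -> : (c - t) * w = (c * w - k%:~R) - (w * t - k%:~R) by ring.
rewrite (le_trans (ler_normB _ _))// addrC lerD2l ger0_norm ?subr_ge0// lerBlDl.
by [].
Qed.

Context {N : nat} {f : R * 'rV[R]_d -> R} (Cf : Cb N f) (p : R * 'rV[R]_d).
Local Notation idx := ('I_N.+1 * {ffun 'I_d -> 'I_N.+1})%type.
Implicit Types (q : R * 'rV[R]_d) (lj : idx).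

Definition hcoef lj : R := 1 / ((lj.1`!)%:R * (mfact lj.2)%:R).

(** The Taylor polynomial of degree less than [N] based at [q], evaluated at the
    fixed point [p]. *)
Definition hermite_poly q : R := \sum_(lj : idx | (lj.1 + mdeg lj.2 < N)%N)
  hcoef lj * (mpartial lj.1 lj.2 f q * (p.1 - q.1) ^+ lj.1 * mpow (p.2 - q.2) lj.2).

Definition top_form q : R := \sum_(lj : idx | (lj.1 + mdeg lj.2 == N)%N)
  hcoef lj * (mpartial lj.1 lj.2 f p * (p.1 - q.1) ^+ lj.1 * mpow (p.2 - q.2) lj.2).

Definition hermite_error q : R := hermite_poly q + top_form q - f p.

Definition hermite_const : R := (d.+1 * #|{ffun option 'I_d -> 'I_N.+1}|)%:R.

Lemma hermite_error_le (rho om : R) q :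
  (forall o, `|coord q o - coord p o| <= rho) ->
  (forall lj, (lj.1 + mdeg lj.2)%N = N ->
    forall z, (forall o, `|coord z o - coord p o| <= rho) ->
    `|mpartial lj.1 lj.2 f z - mpartial lj.1 lj.2 f p| <= om) ->
  `|hermite_error q| <= hermite_const * (rho ^+ N * om).
Proof.
move=> qp fom; have := @hermite_taylor R d N f p q rho om Cf qp
  (fun l j ljN z zp => fom (l, j) ljN z zp).
by rewrite !pair_big_dep distrC.
Qed.

(** The box around [p] reaching the cell has the radius of the most distant
    coordinate, so that only the weight of that coordinate is needed. *)
Lemma cell_error_le (eps M delta w : R) (k : int) (m : 'rV[int]_d) (u : R) (v : 'rV[R]_d) :
  0 < w -> 0 <= eps -> 0 <= M ->
  (forall lj, (lj.1 + mdeg lj.2)%N = N ->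
    forall z, (forall o, `|coord z o - coord p o| < delta) ->
    `|mpartial lj.1 lj.2 f z - mpartial lj.1 lj.2 f p| <= eps) ->
  (forall lj, (lj.1 + mdeg lj.2)%N = N -> forall z,
    `|mpartial lj.1 lj.2 f z - mpartial lj.1 lj.2 f p| <= M) ->
  cell w k u -> (forall i, cell w (m 0 i) (v 0 i)) ->
  w ^+ N * `|hermite_error (u, v)| <= hermite_const *
    \sum_o @weight R N eps M (delta * w) (cell_dist w p k m o).
Proof.
move=> w0 e0 M0 small bounded uk vm.
pose tau := cell_dist w p k m.
have [far_o _ tau_max] := @arg_maxP _ _ _ None xpredT tau isT.
have weight_ge0 o' : 0 <= @weight R N eps M (delta * w) (tau o').
  by rewrite mulr_ge0 ?exprn_ge0 ?cell_dist_ge0// addr_ge0// mulr_ge0.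
have qp o' : `|coord (u, v) o' - coord p o'| <= tau far_o / w.
  apply: (@le_trans _ _ (tau o' / w)); last by rewrite ler_pM2r ?invr_gt0//; exact: tau_max.
  by case: o' => [i|]; exact: cell_distP.
pose om := eps + M * (delta * w <= tau far_o)%R%:R.
have om_le lj : (lj.1 + mdeg lj.2)%N = N ->
    forall z, (forall o', `|coord z o' - coord p o'| <= tau far_o / w) ->
    `|mpartial lj.1 lj.2 f z - mpartial lj.1 lj.2 f p| <= om.
  move=> ljN z zp; rewrite /om.
  have [far|close] := leP (delta * w) (tau far_o).
    by rewrite mulr1 (le_trans (bounded _ ljN z))// lerDr.
  rewrite mulr0 addr0; apply: small => // o'.
  by rewrite (le_lt_trans (zp o'))// ltr_pdivrMr.
have err := hermite_error_le _ _ _ qp om_le.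
apply: (@le_trans _ _ (hermite_const * @weight R N eps M (delta * w) (tau far_o))).
  rewrite /weight mulrC -ler_pdivlMr ?exprn_gt0// (le_trans err)//.
  by rewrite exprMn exprVn le_eqVlt; apply/orP; left; apply/eqP; rewrite /om; ring.
by rewrite ler_wpM2l ?ler0n// (bigD1 far_o)//= lerDl sumr_ge0.
Qed.

End cell_error.

(** * Convergence of the operator *)

Section product_kernel.
Context {R : realType} {d N : nat} {phi : R -> R} {psi : 'I_d -> R -> R}.
Context (hphi : kernel_of_order N phi) (hpsi : forall i, kernel_of_order N (psi i)).

Definition pkernel (w : R) (p : R * 'rV[R]_d) (k : int) (m : 'rV[int]_d) : R :=
  phi (w * p.1 - k%:~R) * \prod_(i < d) psi i (w * p.2 0 i - (m 0 i)%:~R).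

Let ker (o : option 'I_d) : R -> R := if o is Some i then psi i else phi.

(** For each coordinate the sum factors into sums of one variable: the kernel of
    that coordinate carries the weight and contributes the factor [eps], the
    others are merely absolutely summable. *)
Lemma weighted_sum : exists2 A, 0 <= A & forall eps M : R, 0 < eps -> 0 <= M ->
  exists r0, forall r, r0 <= r -> forall w p,
  exists2 B, has_asum2 (fun k m => `|pkernel w p k m| *
    \sum_o @weight R N eps M r (cell_dist w p k m o)) B & B <= A * eps.
Proof.
have hker o : kernel_of_order N (ker o) by case: o => [i|]; [exact: hpsi|exact: hphi].
have /choice[A hA] o : exists A, 0 <= A /\
    (forall u, exists2 B, nneg_sum (fun k : int => `|ker o (u - k%:~R)|) B & B <= A) /\
    (forall eps M, 0 < eps -> 0 <= M -> exists r0, forall r, r0 <= r -> forall u,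
      exists2 B, nneg_sum (fun k : int => `|ker o (u - k%:~R)| *
        @weight R N eps M r (`|u - k%:~R| + 1)) B & B <= A * eps).
  by have [A A0 hA] := kernel_weight (hker o); exists A.
exists (d.+1%:R * \prod_o A o).
  by rewrite mulr_ge0// prodr_ge0// => o _; have [] := hA o.
move=> eps M e0 M0.
have /choice[r0 hr0] o : exists r0, forall r, r0 <= r -> forall u,
    exists2 B, nneg_sum (fun k : int => `|ker o (u - k%:~R)| *
        @weight R N eps M r (`|u - k%:~R| + 1)) B & B <= A o * eps.
  by have [_ [_ /(_ eps M e0 M0)]] := hA o.
exists (\sum_o `|r0 o|) => r r0r w p.
have {}r0r o : r0 o <= r.
  rewrite (le_trans (ler_norm _))// (le_trans _ r0r)// (bigD1 o)//= lerDl.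
  by rewrite sumr_ge0.
pose K o (k : int) := `|ker o (w * coord p o - k%:~R)|.
(* The factor of the coordinate [o'] when the weight sits on the coordinate [o]. *)
pose W o o' (k : int) := if o' == o then
  @weight R N eps M r (`|w * coord p o' - k%:~R| + 1) else 1.
have /choice[b hb] (oo : option 'I_d * option 'I_d) : exists b,
    nneg_sum (fun k => K oo.2 k * W oo.1 oo.2 k) b /\
    b <= A oo.2 * (if oo.2 == oo.1 then eps else 1).
  case: oo => o o' /=; rewrite /W; case: ifPn => [_|_].
    by have [b hb bA] := hr0 o' r (r0r o') (w * coord p o'); exists b.
  have [_ [/(_ (w * coord p o'))[b hb bA] _]] := hA o'.
  exists b; rewrite mulr1; split=> //; move: hb; congr nneg_sum.
  by apply/funext => k; rewrite mulr1.
exists (\sum_o \prod_o' b (o, o')); last first.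
  apply: (@le_trans _ _ (\sum_(o : option 'I_d) (\prod_o' A o') * eps)).
    apply: ler_sum => o _.
    rewrite (_ : _ * eps = \prod_o' (A o' * (if o' == o then eps else 1))).
      apply: ler_prod => o' _; have [bo bA] := hb (o, o').
      by rewrite (nneg_sum_ge0 _ _ bo).
    by rewrite big_split /= -[in RHS]big_mkcond big_pred1_eq.
  by rewrite sumr_const card_option card_ord mulr_natl mulrnAl.
pose cell_idx (k : int) (m : 'rV[int]_d) (o : option 'I_d) := if o is Some i then m 0 i else k.
have term o : has_asum2 (fun k m => \prod_o' (K o' (cell_idx k m o') * W o o' (cell_idx k m o')))
    (\prod_o' b (o, o')).
  rewrite big_option /=.
  have := has_asum2M _ _ _ _ (nneg_sum_has_asum _ _ (hb (o, None)).1)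
    (has_asum_prod _ _ _ (fun i => nneg_sum_has_asum _ _ (hb (o, Some i)).1)).
  by apply: eq_has_asum2 => k m; rewrite [RHS]big_option.
apply: eq_has_asum2 (has_asum2_sum _ (index_enum _) xpredT _ _ (fun o _ => term o)) => k m.
rewrite mulr_sumr; apply: eq_bigr => o _.
rewrite big_split /= -[X in _ * X]big_mkcond big_pred1_eq.
by congr (_ * _); rewrite /pkernel normrM normr_prod big_option.
Qed.

End product_kernel.

Section limit_constant.
Context {R : realType} {d N : nat}.

Definition mean_moment (mchi : nat -> R) (l : nat) : R :=
  \sum_(c < l.+1) 'C(l, c)%:R / (l - c + 1)%:R * mchi c.

Lemma mbinomE (j e : {ffun 'I_d -> 'I_N.+1}) : mle e j ->
  mbinom R j e = \prod_i 'C(j i, e i)%:R.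
Proof.
move=> /forallP ej; rewrite /mbinom /mfact !natr_prod -big_split /= -prodf_div.
apply: eq_bigr => i _; rewrite -(bin_fact (ej i)) !natrM mulfK//.
Qed.

(** The box [e <= j] is a product of intervals. *)
Lemma sum_mle (F : 'I_d -> nat -> R) (j : {ffun 'I_d -> 'I_N.+1}) :
  \sum_(e : {ffun 'I_d -> 'I_N.+1} | mle e j) \prod_i F i (e i) =
  \prod_i \sum_(a < (j i).+1) F i a.
Proof.
transitivity (\prod_i \sum_(a < N.+1 | (a <= j i)%N) F i a).
  rewrite bigA_distr_big_dep; apply: eq_bigl => e.
  by apply/forallP/familyP => ej i; have := ej i.
apply: eq_bigr => i _.
by rewrite [RHS](big_ord_widen _ (fun a => F i a) (ltn_ord (j i))).
Qed.

(** The double sum of the limit factors over the coordinates, since the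
    multi-index binomial coefficient does. *)
Lemma limit_coefE (mphi : nat -> R) (mpsi : 'I_d -> nat -> R) (l : nat)
    (j : {ffun 'I_d -> 'I_N.+1}) (D : R) :
  \sum_(c < l.+1) \sum_(e : {ffun 'I_d -> 'I_N.+1} | mle e j)
    'C(l, c)%:R * mbinom R j e * (mphi c / (l - c + 1)%:R) *
    (\prod_(i < d) (mpsi i (e i) / (j i - e i + 1)%:R)) * D =
  mean_moment mphi l * (\prod_i mean_moment (mpsi i) (j i)) * D.
Proof.
rewrite /mean_moment -(sum_mle (fun i a => 'C(j i, a)%:R / (j i - a + 1)%:R * mpsi i a)).
rewrite !mulr_suml; apply: eq_bigr => c _.
rewrite mulr_sumr mulr_suml; apply: eq_bigr => e ej; congr (_ * _).
rewrite mbinomE//.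
have -> : \prod_i ('C(j i, e i)%:R / (j i - e i + 1)%:R * mpsi i (e i)) =
    (\prod_i 'C(j i, e i)%:R) * \prod_i (mpsi i (e i) / (j i - e i + 1)%:R) :> R.
  by rewrite -big_split /=; apply: eq_bigr => i _; ring.
by ring.
Qed.

End limit_constant.

Section operator_expansion.
Context {R : realType} {d n : nat}.
Context {f : R * 'rV[R]_d -> R} (Cf : Cb n.+1 f) (p : R * 'rV[R]_d).
Local Notation idx := ('I_n.+2 * {ffun 'I_d -> 'I_n.+2})%type.
Local Notation deg lj := (lj.1 + mdeg lj.2)%N.
Implicit Types (q : R * 'rV[R]_d) (lj : idx).

Definition monomial lj q : R := (q.1 - p.1) ^+ lj.1 * mpow (q.2 - p.2) lj.2.

Lemma monomial_continuous lj : continuous (monomial lj).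
Proof.
have cm : continuous (fun v : 'rV[R]_d => mpow (v - p.2) lj.2).
  have -> : (fun v : 'rV[R]_d => mpow (v - p.2) lj.2) =
      (fun v => \prod_i (v 0 i - p.2 0 i) ^+ lj.2 i).
    by apply/funext => v; apply: eq_bigr => i _; rewrite !mxE.
  apply: (@continuous_coord_prod R d (fun i t => (t - p.2 0 i) ^+ lj.2 i)) => i t.
  apply: (@continuous_comp _ _ _ (fun t : R => t - p.2 0 i) (fun t => t ^+ lj.2 i)).
    by apply: cvgB; [exact: cvg_id|exact: cvg_cst].
  exact: exprn_continuous.
move=> q; apply: cvgM.
  apply: (@continuous_comp _ _ _ (fun q : R * 'rV[R]_d => q.1 - p.1) (fun t => t ^+ lj.1)).
    by apply: cvgB; [exact: cvg_fst|exact: cvg_cst].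
  exact: exprn_continuous.
apply: (@continuous_comp _ _ _ snd (fun v : 'rV[R]_d => mpow (v - p.2) lj.2)); last exact: cm.
exact: cvg_snd.
Qed.

Lemma reflect_monomial lj q (c : R) :
  c * (p.1 - q.1) ^+ lj.1 * mpow (p.2 - q.2) lj.2 = (-1) ^+ deg lj * c * monomial lj q.
Proof.
have -> : mpow (p.2 - q.2) lj.2 = (-1) ^+ mdeg lj.2 * mpow (q.2 - p.2) lj.2.
  rewrite /mpow /mdeg -prodrXr -big_split /=; apply: eq_bigr => i _.
  by rewrite !mxE -exprMn mulN1r opprB.
have -> : (p.1 - q.1) ^+ lj.1 = (-1) ^+ lj.1 * (q.1 - p.1) ^+ lj.1.
  by rewrite -exprMn mulN1r opprB.
rewrite exprD /monomial; move: ((-1) ^+ lj.1) ((-1) ^+ mdeg lj.2) => s t; ring.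
Qed.

Lemma hermite_poly_continuous : continuous (@hermite_poly R d n.+1 f p).
Proof.
rewrite /hermite_poly; apply: continuous_big => [|lj ljn]; first exact: add_continuous.
under eq_fun do rewrite reflect_monomial.
move=> q; apply: cvgM; first exact: cvg_cst.
apply: cvgM; last exact: monomial_continuous.
apply: cvgM; first exact: cvg_cst.
by apply: (@Cb_continuous _ _ (n.+1 - deg lj)); apply: Cb_mpartial => //; exact: ltnW.
Qed.

Definition top_coef lj : R := hcoef lj * (-1) ^+ n * mpartial lj.1 lj.2 f p.

(** The sign [(-1) ^ n] of the limit comes from reflecting [p - q] into [q - p]
    in degree [n + 1], and from moving the leading form to the other side. *)
Lemma hermite_poly_split q : @hermite_poly R d n.+1 f p q =
  f p * 1 + \sum_(lj : idx | deg lj == n.+1) top_coef lj * monomial lj q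
  + @hermite_error R d n.+1 f p q.
Proof.
rewrite /hermite_error /top_form.
have -> : \sum_(lj : idx | deg lj == n.+1) hcoef lj *
     (mpartial lj.1 lj.2 f p * (p.1 - q.1) ^+ lj.1 * mpow (p.2 - q.2) lj.2) =
   - \sum_(lj : idx | deg lj == n.+1) top_coef lj * monomial lj q.
  rewrite -sumrN; apply: eq_bigr => lj /eqP ljn.
  by rewrite reflect_monomial ljn /top_coef exprS; ring.
by rewrite mulr1; ring.
Qed.

Let top_sum_continuous : continuous (fun q =>
  \sum_(lj : idx | deg lj == n.+1) top_coef lj * monomial lj q).
Proof.
apply: continuous_big => [|lj _]; first exact: add_continuous.
by move=> q; apply: cvgM; [exact: cvg_cst|exact: monomial_continuous].
Qed.

Lemma hermite_error_continuous : continuous (@hermite_error R d n.+1 f p).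
Proof.
have -> : @hermite_error R d n.+1 f p = (fun q => @hermite_poly R d n.+1 f p q -
   (f p * 1 + \sum_(lj : idx | deg lj == n.+1) top_coef lj * monomial lj q)).
  by apply/funext => q; rewrite hermite_poly_split addrC addKr.
move=> q; apply: cvgB; first exact: hermite_poly_continuous.
by apply: cvgD; [exact: cvg_cst|exact: top_sum_continuous].
Qed.

Lemma cell_mean_hermite_poly (w : R) k m : 0 < w ->
  w ^+ n.+1 * cell_mean w k m (@hermite_poly R d n.+1 f p) =
  w ^+ n.+1 * f p +
  \sum_(lj : idx | deg lj == n.+1) top_coef lj *
    (mean_pow lj.1 (k%:~R - w * p.1) *
     \prod_i mean_pow (lj.2 i) ((m 0 i)%:~R - w * p.2 0 i)) +
  w ^+ n.+1 * cell_mean w k m (@hermite_error R d n.+1 f p).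
Proof.
move=> w0; have -> : @hermite_poly R d n.+1 f p = (fun q => f p * 1 +
    \sum_(lj : idx | deg lj == n.+1) top_coef lj * monomial lj q +
    @hermite_error R d n.+1 f p q).
  by apply/funext => q; exact: hermite_poly_split.
have c1 : continuous (fun _ : R * 'rV[R]_d => f p * 1) by move=> ?; exact: cvg_cst.
rewrite cell_meanD//; last exact: hermite_error_continuous.
  rewrite cell_meanD// cell_meanZ//; last by move=> ?; exact: cvg_cst.
  rewrite cell_mean1// mulr1 !mulrDr; congr (_ + _ + _).
  rewrite cell_mean_sum// => [|lj _]; last exact: monomial_continuous.
  rewrite mulr_sumr; apply: eq_bigr => lj /eqP ljn.
  by rewrite mulrCA -cell_mean_monomial// ljn.
by move=> q; apply: cvgD; [exact: c1|exact: top_sum_continuous].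
Qed.

Lemma inner_sum_cell_mean (w : R) (k : int) (m : 'rV[int]_d) : 0 < w ->
  \sum_(l < n.+1)
      \sum_(j : {ffun 'I_d -> 'I_n.+1} | (l + mdeg j <= n)%N)
        (1 / ((l`!)%:R * (mfact j)%:R) * w ^+ d.+1 *
         \int[lebesgue_measure]_(u in cell w k)
           box_integral (fun i => cell w (m 0 i))
             (fun v => mpartial l j f (u, v) * (p.1 - u) ^+ l * mpow (p.2 - v) j)) =
  cell_mean w k m (@hermite_poly R d n.+1 f p).
Proof.
move=> w0.
pose G (l : nat) (j : 'I_d -> nat) : R :=
  1 / ((l`!)%:R * (\prod_i (j i)`!)%N%:R) * w ^+ d.+1 *
         \int[lebesgue_measure]_(u in cell w k)
           box_integral (fun i => cell w (m 0 i))
             (fun v => iter l (partial None)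
               (foldr (fun i g => iter (j i) (partial (Some i)) g) f (enum 'I_d)) (u, v)
               * (p.1 - u) ^+ l * \prod_i (p.2 - v) 0 i ^+ j i).
rewrite (widen_multi_index n G) pair_big_dep /=.
rewrite /hermite_poly cell_mean_sum// => [|lj ljn].
  by apply: eq_bigr => lj _; rewrite /G /cell_mean -mulrA.
have -> : (fun q => mpartial lj.1 lj.2 f q * (p.1 - q.1) ^+ lj.1 * mpow (p.2 - q.2) lj.2) =
  (fun q => (-1) ^+ deg lj * mpartial lj.1 lj.2 f q * monomial lj q).
  by apply/funext => q; rewrite reflect_monomial.
move=> q; apply: cvgM; last exact: monomial_continuous.
apply: cvgM; first exact: cvg_cst.
by apply: (@Cb_continuous _ _ (n.+1 - deg lj)); apply: Cb_mpartial => //; exact: ltnW.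
Qed.

End operator_expansion.

Section voronovskaya.
Context {R : realType} {d n : nat} {phi : R -> R} {psi : 'I_d -> R -> R}.
Context (hphi : kernel_of_order n.+1 phi) (hpsi : forall i, kernel_of_order n.+1 (psi i)).
Context (mphi : nat -> R) (mpsi : 'I_d -> nat -> R).
Context (hmphi : forall r, (r <= n.+1)%N -> forall u, moment r phi u = mphi r)
  (hmpsi : forall i r, (r <= n.+1)%N -> forall u, moment r (psi i) u = mpsi i r).
Context {f : R * 'rV[R]_d -> R} (Cf : Cb n.+1 f) (p : R * 'rV[R]_d).
Local Notation idx := ('I_n.+2 * {ffun 'I_d -> 'I_n.+2})%type.
Local Notation deg lj := (lj.1 + mdeg lj.2)%N.

Definition limit_constant : R := \sum_(lj : idx | deg lj == n.+1) @top_coef R d n f p lj *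
  (mean_moment mphi lj.1 * \prod_i mean_moment (mpsi i) (lj.2 i)).

Lemma has_asum2_pkernel w : has_asum2 (@pkernel R d phi psi w p) 1.
Proof.
have := has_asum2M _ _ _ _ (has_asum_kernel hphi (w * p.1))
  (has_asum_prod _ _ _ (fun i => has_asum_kernel (hpsi i) (w * p.2 0 i))).
by rewrite big1 ?mulr1.
Qed.

Lemma has_asum2_pkernel_monomial w (lj : idx) : deg lj = n.+1 ->
  has_asum2 (fun k m => @pkernel R d phi psi w p k m *
    (mean_pow lj.1 (k%:~R - w * p.1) *
     \prod_i mean_pow (lj.2 i) ((m 0 i)%:~R - w * p.2 0 i)))
  (mean_moment mphi lj.1 * \prod_i mean_moment (mpsi i) (lj.2 i)).
Proof.
move=> ljn.
have ln : (lj.1 <= n.+1)%N by rewrite (leq_trans (leq_addr _ _) (eq_leq ljn)).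
have jn i : (lj.2 i <= n.+1)%N.
  rewrite (leq_trans _ (eq_leq ljn))// (leq_trans _ (leq_addl _ _))//.
  by rewrite /mdeg (bigD1 i)//= leq_addr.
have := has_asum2M _ _ _ _ (has_asum_mean_pow hphi mphi hmphi lj.1 (w * p.1) ln)
  (has_asum_prod _ _ _ (fun i =>
     has_asum_mean_pow (hpsi i) (mpsi i) (hmpsi i) (lj.2 i) (w * p.2 0 i) (jn i))).
apply: eq_has_asum2 => k m; rewrite /pkernel big_split /=.
by rewrite mulrACA.
Qed.

(** For every [w > 0] the rescaled deviation equals the limit plus a sum [s]
    stemming from [hermite_error], and only [s] has to be estimated. *)
Lemma operator_limit :
  w ^+ n.+1 * (hermite_kantorovich n phi psi w f p.1 p.2 - f p) @[w --> +oo] -->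
  limit_constant.
Proof.
have [A A0 hA] := weighted_sum hphi hpsi.
apply/cvgrPdist_le => e e0.
pose C : R := @hermite_const R d n.+1.
have CA1 : 0 < C * A + 1 by rewrite ltr_wpDl// mulr_ge0// ler0n.
(* [s] will be bounded by [C * (A * eps)]. *)
pose eps := e / (C * A + 1); have eps0 : 0 < eps by rewrite divr_gt0.
have [delta delta0 small] := top_near Cf p _ eps0.
have [M M0 bounded] := top_bound Cf p.
have [r0 hr0] := hA eps M eps0 M0.
near=> w.
have w0 : 0 < w by near: w; exact: nbhs_pinfty_gt.
have wN0 : 0 < w ^+ n.+1 by rewrite exprn_gt0.
have r0w : r0 <= delta * w.
  by rewrite mulrC -ler_pdivrMr//; near: w; exact: nbhs_pinfty_ge.
have [B hB BA] := hr0 _ r0w w p.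
pose err := @hermite_error R d n.+1 f p.
have [|s hs sB] := has_asum2_le (fun k m => @pkernel R d phi psi w p k m *
  (w ^+ n.+1 * cell_mean w k m err)) _ _ _ (has_asum2Z C _ _ hB).
  move=> k m; rewrite /= normrM [leRHS]mulrCA ler_wpM2l// normrM (gtr0_norm wN0).
  rewrite mulrC -ler_pdivlMr//; apply: cell_mean_bound => //.
    exact: hermite_error_continuous.
  move=> u v uk vm; rewrite ler_pdivlMr// mulrC.
  by apply: cell_error_le => //; exact: ltW.
have hK : has_asum2 (fun k m => w ^+ n.+1 * (@pkernel R d phi psi w p k m *
    cell_mean w k m (@hermite_poly R d n.+1 f p)))
    (w ^+ n.+1 * f p + limit_constant + s).
  have h1 := has_asum2Z (w ^+ n.+1 * f p) _ _ (has_asum2_pkernel w).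
  have h2 := has_asum2_sum _ (index_enum idx) (fun lj => deg lj == n.+1) _ _
    (fun lj (ljn : deg lj == n.+1) => has_asum2Z (@top_coef R d n f p lj) _ _
       (has_asum2_pkernel_monomial w lj (eqP ljn))).
  have := has_asum2D _ _ _ _ (has_asum2D _ _ _ _ h1 h2) hs.
  rewrite mulr1; apply: eq_has_asum2 => k m.
  rewrite [RHS]mulrCA cell_mean_hermite_poly// !mulrDr mulr_sumr.
  congr (_ + _ + _); first by rewrite mulrC.
  by apply: eq_bigr => lj _; rewrite mulrCA.
have KE : hermite_kantorovich n phi psi w f p.1 p.2 =
    (w ^+ n.+1)^-1 * (w ^+ n.+1 * f p + limit_constant + s).
  rewrite -(has_asum2E _ _ (has_asum2Z (w ^+ n.+1)^-1 _ _ hK)).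
  rewrite /hermite_kantorovich; congr asum; apply/funext => k.
  congr asum; apply/funext => m.
  by rewrite mulKf ?gt_eqF// inner_sum_cell_mean.
rewrite KE mulrBr mulVKf ?gt_eqF//.
have -> : limit_constant - (w ^+ n.+1 * f p + limit_constant + s - w ^+ n.+1 * f p) = - s.
  by ring.
rewrite normrN (le_trans sB)// (le_trans (ler_wpM2l _ BA)) ?ler0n//.
rewrite mulrA /eps mulrCA ler_piMr ?(ltW e0)// ler_pdivrMr// mul1r lerDl.
by [].
Unshelve. all: by end_near. Qed.

End voronovskaya.

Theorem theorem3 (R : realType) (d n : nat) (hd : (1 <= d)%N)
  (phi : R -> R) (psi : 'I_d -> R -> R)
  (hphi : kernel_of_order n.+1 phi)
  (hpsi : forall i, kernel_of_order n.+1 (psi i))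
  (mphi : nat -> R) (mpsi : 'I_d -> nat -> R)
  (hmphi : forall r, (r <= n.+1)%N ->
    (forall u, moment r phi u = mphi r) /\ mphi r != 0)
  (hmpsi : forall i r, (r <= n.+1)%N ->
    (forall u, moment r (psi i) u = mpsi i r) /\ mpsi i r != 0)
  (f : R * 'rV[R]_d -> R) (hf : Cb n.+1 f) (x : R) (y : 'rV[R]_d) :
  w ^+ n.+1 * (hermite_kantorovich n phi psi w f x y - f (x, y))
    @[w --> +oo] -->
  \sum_(l < n.+2)
    \sum_(j : {ffun 'I_d -> 'I_n.+2} | (l + mdeg j == n.+1)%N)
      (-1) ^+ n / ((l`!)%:R * (mfact j)%:R) *
      \sum_(c < l.+1) \sum_(e : {ffun 'I_d -> 'I_n.+2} | mle e j)
        'C(l, c)%:R * mbinom R j e * (mphi c / (l - c + 1)%:R) *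
        (\prod_(i < d) (mpsi i (e i) / (j i - e i + 1)%:R)) *
        mpartial l j f (x, y).
Proof.
have := operator_limit hphi hpsi mphi mpsi (fun r rn => (hmphi r rn).1)
  (fun i r rn => (hmpsi i r rn).1) hf (x, y).
rewrite /limit_constant -(pair_big_dep xpredT
  (fun (l : 'I_n.+2) (j : {ffun 'I_d -> 'I_n.+2}) => (l + mdeg j == n.+1)%N)
  (fun l j => top_coef (x, y) (l, j) *
     (mean_moment mphi l * \prod_i mean_moment (mpsi i) (j i)))) /=.
congr (_ --> _); apply: eq_bigr => l _; apply: eq_bigr => j _.
by rewrite limit_coefE /top_coef /hcoef /=; ring.
Qed.
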